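(* There exist absolute constants $A,A'>0$ such that the following holds. Let $(\nu(i))_{i\ge0}$ be a positive decreasing sequence such that $\sum_{i=0}^{\infty}\sqrt{\nu(i)/(i+1)}<\infty$ and $E((f(X_{i,m})-f(X_i))^2)\le \nu(i)$ for all integers $i,m\ge 0$, and suppose that $\nu(i)\le c\,e^{-\xi i}$ for all $i\ge0$, where $c>0$ and $0<\xi\le1$ are constants. Let $\delta\in(1,2]$, $\theta(x)=\max(1,x)^\delta$ for $x\ge0$, and $p_l=\frac{1}{\theta(l)2^l}-\frac1{\theta(l+1)2^{l+1}}$ for $l\ge0$. Let $q\in(0,1]$ and let $\hat f_k$ be the estimator built from $(p_l)_{l\ge0}$ and $q$, with expected simulation time $\hat T_k$. Then $$\sum_{l=0}^\infty\frac1{\theta(l)}<\infty,\qquad \sum_{i=0}^\infty\sqrt{\frac{\nu(i)\,\theta(\log_2(4i+1))}{i+1}}<\infty,$$ and, for every $k\ge1$, $$\hat T_k\le k\Big(1+\frac{9q}{\delta-1}\Big)$$ and $$k\operatorname{Var}(\hat f_k)\le k\operatorname{Var}(f_k)+\frac{Ac}{\xi}\sqrt{\frac{b'(k)-b(k)}{k}}+\frac{Ac}{q\xi}\min\left(\ln^{\delta}\Big(\frac3\xi\Big),\frac{e^{-\xi b'(k)/2}}{\xi}\right).$$ Moreover, if in addition $\nu(i)\le c/(i+1)$ for all $i\ge0$, then for every $k\ge1$ $$k\operatorname{Var}(\hat f_k)\le k\operatorname{Var}(f_k)+A'c\ln^{2}\Big(\frac3\xi\Big)\sqrt{\frac{b'(k)-b(k)}{k}}+\frac{A'c}{q}\min\left(\ln^{\delta+2}\Big(\frac3\xi\Big),\frac{e^{-\xi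 b'(k)/2}}{\xi^2}\right).$$
   Context: Setting: $F,F'$ are measurable spaces, $g:F\times F'\to F$ is measurable, $(U_i)_{i\in\mathbb Z}$ are i.i.d. $F'$-valued random variables, $X_0\in F$ is deterministic, and $X_{i+1}=g(X_i,U_i)$ for $i\ge0$. The function $f:F\to\mathbb R$ is measurable and $f(X_i)$ is square-integrable for every $i\ge0$. For $m\in\mathbb Z$, $(X_{i,m})_{i\ge -m}$ is defined by $X_{-m,m}=X_0$ and $X_{i+1,m}=g(X_{i,m},U_i)$ for $i\ge -m$; in particular $X_{i,0}=X_i$ for $i\ge0$. Estimators: for $k\ge1$ fix integers $0\le b(k)\le b'(k)\le k/2$ and set $$f_k=\frac1{k-b(k)}\sum_{i=b(k)}^{k-1}f(X_i),\qquad f_{k,l}=\frac1{k-b'(k)}\sum_{i=b'(k)}^{k-1}f(X_{i,k(2^l-1)})\quad(l\ge0).$$ Given a probability distribution $(p_l)_{l\ge0}$ on the non-negative integers with all $p_l>0$, let $N$ be independent of $(U_i)_{i\in\mathbb Z}$ with $\Pr(N=l)=p_l$, and $Z_k=(f_{k,N+1}-f_{k,N})/p_N$. Given $q\in(0,1]$, let $Z'_k$ be a copy of $Z_k$ independent of $f_{k,0}$, let $Q\in\{0,1\}$ be independent of $(f_{k,0},Z'_k)$ with $\Pr(Q=1)=q$, and set $\hat f_k=f_{k,0}+q^{-1}QZ'_k$. Cost model: simulating $f_k$ takes expected time $k$, and simulating $f_{k,l}$ takes expected time $k2^l$, so the expected time $\tau_{k,l}$ to simulate $f_{k,l+1}-f_{k,l}$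 satisfies $\tau_{k,l}\le k2^{l+1}+k2^l=3k2^l$. The expected time to simulate $Z_k$ is $T_k=\sum_{l\ge0}p_l\tau_{k,l}$, and the expected time to simulate $\hat f_k$ is $\hat T_k=k+qT_k$. ''Absolute'' means that $A,A'$ do not depend on any of the data (spaces, chain, $f$, $\nu$, $c$, $\xi$, $\delta$, $q$, $k$, $b$, $b'$). $\ln^{a}(x)$ means $(\ln x)^a$. *)

(* Defs.v *)
From HB Require Import structures.
From mathcomp Require Import all_boot all_order all_algebra finmap.
From mathcomp Require Import all_classical all_reals all_analysis.

Set Implicit Arguments.
Unset Strict Implicit.
Unset Printing Implicit Defensive.

Import Order.TTheory GRing.Theory Num.Theory.
Import numFieldNormedType.Exports.

Local Open Scope classical_set_scope.
Local Open Scope ring_scope.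

Section Laws.
Context d (Omega : measurableType d) (R : realType) (P : probability Omega R).

Definition same_law d1 (T : measurableType d1) (X Y : Omega -> T) : Prop :=
  forall B, measurable B -> P (X @^-1` B) = P (Y @^-1` B).

Definition independent_rv d1 d2 (T1 : measurableType d1)
    (T2 : measurableType d2) (X : Omega -> T1) (Y : Omega -> T2) : Prop :=
  forall A B, measurable A -> measurable B ->
    P (X @^-1` A `&` Y @^-1` B) = (P (X @^-1` A) * P (Y @^-1` B))%E.

Definition mutually_independent (I : choiceType) d1 (T : measurableType d1)
    (X : I -> Omega -> T) : Prop :=
  forall (J : {fset I}) (B : I -> set T), (forall i, measurable (B i)) ->
    P (\bigcap_(i in [set` J]) X i @^-1` B i)
    = (\prod_(i <- J) P (X i @^-1` B i))%E.

Definition iid (I : choiceType) d1 (T : measurableType d1)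
    (X : I -> Omega -> T) : Prop :=
  mutually_independent X /\ forall i j, same_law (X i) (X j).

(* The sigma-algebra sigma(X_i : i in I) on Omega. *)
Definition sigma_family (I : Type) d1 (T : measurableType d1)
    (X : I -> Omega -> T) : set (set Omega) :=
  <<s \bigcup_i preimage_set_system setT (X i) measurable >>.

Definition independent_of_family (I : Type) d1 d2 (T1 : measurableType d1)
    (T2 : measurableType d2) (Y : Omega -> T1) (X : I -> Omega -> T2) : Prop :=
  forall A E, measurable A -> sigma_family X E ->
    P (Y @^-1` A `&` E) = (P (Y @^-1` A) * P E)%E.

End Laws.

Section Chain.
Variables (Omega F F' : Type) (g : F * F' -> F) (X0 : F).

Fixpoint driven (V : nat -> Omega -> F') (n : nat) (w : Omega) : F :=
  if n is n'.+1 then g (driven V n' w, V n' w) else X0.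

Variable U : int -> Omega -> F'.

Definition chain (i : nat) : Omega -> F := driven (fun n => U n%:Z) i.

(* X_{i,m}: the chain started from X0 at time -m and driven by U_{-m},
   U_{-m+1} and so on; only the indices with - m <= i are meaningful. *)
Definition chain_from (i m : int) : Omega -> F :=
  driven (fun n => U (n%:Z - m)) (absz (i + m)).

Lemma chain_fromN (m : int) w : chain_from (- m) m w = X0.
Proof. by rewrite /chain_from addNr. Qed.

Lemma chain_fromS (i m : int) w : - m <= i ->
  chain_from (i + 1) m w = g (chain_from i m w, U i w).
Proof.
rewrite -subr_ge0 opprK => im; rewrite /chain_from addrAC.
have -> : absz (i + m + 1) = (absz (i + m)).+1.
  by move: im; case: (i + m) => // n _; rewrite -PoszD addn1.
by rewrite /= gez0_abs// addrK.
Qed.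

Lemma chain_from0 (i : nat) w : chain_from i 0 w = chain i w.
Proof.
rewrite /chain_from /chain addr0 /=.
by congr (driven _ _ w); apply/funext => n; rewrite subr0.
Qed.

End Chain.

Section Estimators.
Context (R : realType) (Omega F F' : Type).
Variables (g : F * F' -> F) (X0 : F) (U : int -> Omega -> F') (f : F -> R).
Variables (b b' : nat -> nat).

Definition fk (k : nat) (w : Omega) : R :=
  (k%:R - (b k)%:R)^-1 * \sum_(b k <= i < k) f (chain g X0 U i w).

Definition fkl (k l : nat) (w : Omega) : R :=
  (k%:R - (b' k)%:R)^-1 *
  \sum_(b' k <= i < k) f (chain_from g X0 U i (k * (2 ^ l - 1))%N w).

Definition Zk (p : nat -> R) (N : Omega -> nat) (k : nat) (w : Omega) : R :=
  (fkl k (N w).+1 w - fkl k (N w) w) / p (N w).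

Definition fhat (q : R) (Q : nat -> Omega -> bool) (Z' : nat -> Omega -> R)
    (k : nat) (w : Omega) : R :=
  fkl k 0 w + q^-1 * (Q k w)%:R * Z' k w.

End Estimators.

Section Cost.
Context (R : realType).
(* tau k l is the expected time to simulate f_{k,l+1} - f_{k,l} *)
Variables (p : nat -> R) (tau : nat -> nat -> R).

Definition Tk (k : nat) : \bar R := (\sum_(0 <= l <oo) (p l * tau k l)%:E)%E.

Definition That (q : R) (k : nat) : \bar R := (k%:R%:E + q%:E * Tk k)%E.

End Cost.

Section Weights.
Context (R : realType).

Definition theta (delta x : R) : R := Num.max 1 x `^ delta.

Definition p_theta (delta : R) (l : nat) : R :=
  1 / (theta delta l%:R * 2 ^+ l) -
  1 / (theta delta l.+1%:R * 2 ^+ l.+1).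

Definition log2 (x : R) : R := ln x / ln 2.

End Weights.

(* Main.v *)
(* Let w_a(n) be f of the chain after n steps, started from X0 at time a and
   driven by U_a, ..., U_{a+n-1}. The law of (w_a(m+n), w_{a+m}(n)) does not
   depend on a, so E (w_a(m+n) - w_{a+m}(n))^2 <= nu(n) for every a.

   Comparing Var f_{k,0} with Var f_k: f(X_j) is a constant plus increments
   D_{j,s} between the chains restarted 2^s and 2^(s-1) steps before j. At
   level s, E D^2 <= nu(2^(s-1)) and D_{j,s}, D_{i,s} are independent as soon as
   |i - j| >= 2^s, so a sum of n terms f(X_j) has variance at most 2 n M^2 with
   M = sum_s sqrt(2^s nu(2^(s-1))).

   Randomisation: Var fhat_k <= Var f_{k,0} + E Z_k^2 / q, and by Jensen
   k E Z_k^2 <= 4 sum_l theta(l) 2^l sum_{b' <= i < k} nu(i + k (2^l - 1)).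

   Both series then compare a geometric growth with the decay exp(-xi 2^l): terms
   of the form y / ((1 + y)(1 + 2 y)) along y = y_0 2^l telescope, and when
   nu(i) <= c / (i + 1) the terms are O(1) until 2^l exceeds xi^-2, that is for
   O(ln (3 / xi)) indices, and decay geometrically afterwards. *)

Require Import Defs.
From HB Require Import structures.
From mathcomp Require Import all_boot all_order all_algebra finmap.
From mathcomp Require Import all_classical all_reals all_analysis measurable_realfun.
From mathcomp Require Import ring lra zify.

Set Implicit Arguments.
Unset Strict Implicit.
Unset Printing Implicit Defensive.

Import Order.TTheory GRing.Theory Num.Theory.
Import numFieldNormedType.Exports.

Local Open Scope classical_set_scope.
Local Open Scope ring_scope.

(** The hypothesis on [nu] compares a chain only with its restarted copies and gives no decay of
    covariances. Restarting supplies it: increments over disjoint time windows are functions of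
    disjoint sets of innovations, so their covariances are exactly zero. The term in sqrt((b' - b) /
    k) comes from the two burn-in lengths. With v and u the centered averages over [b', k) and [b,
    k), E (v - u)^2 is at most of order (b' - b) M^2 / k^2, E (v + u)^2 at most of order M^2 / k,
    and v^2 - u^2 = (v - u)(v + u). The factor ln^delta (3 / xi) is the size of theta(l) at the
    level where 2^l reaches 1 / xi; beyond it the growth of theta is polynomial in xi k 2^l and is
    absorbed by the exponential. The second entry of each minimum keeps the decay in b' and trades
    the logarithm for a power of 1 / xi. The threshold xi^-2, rather than xi^-1, makes constants
    uniform in xi: for z >= xi^-2, half of a sixth power of xi z cancels xi and leaves exp (- xi z /
    2) = O(z^-3). *)

(** * Elementary inequalities and explicit sums *)

Section RealBounds.
Context (R : realType).
Implicit Types x y r c xi delta : R.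

Lemma nneseries_le (u : nat -> R) (B : R) : (forall l, 0 <= u l) ->
  (forall n, \sum_(0 <= l < n) u l <= B) ->
  (\sum_(0 <= l <oo) (u l)%:E <= B%:E)%E.
Proof.
move=> u0 uB; apply: lime_le.
  by apply: is_cvg_nneseries => l _ _; rewrite lee_fin.
by apply: nearW => n; rewrite sumEFin lee_fin.
Qed.

(** Used with degrees 2, 4, 5 and 6, each chosen to beat the polynomial factor at hand. *)
Lemma expR_ge_pow (n : nat) x : 0 <= x -> (1 + x / n.+1%:R) ^+ n.+1 <= expR x.
Proof.
move=> x0.
have -> : expR x = expR (x / n.+1%:R) ^+ n.+1 by rewrite -expRM_natr divfK.
by rewrite lerXn2r ?nnegrE ?expR_ge0 ?expR_ge1Dx// addr_ge0// divr_ge0.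
Qed.

Lemma expR1_le3 : expR 1 <= 3 :> R.
Proof.
(* Six is the least n with (n / (n - 1))^n <= 3: (6 / 5)^6 = 2.985984. *)
have -> : expR 1 = (expR (- 6^-1) ^+ 6)^-1 :> R.
  by rewrite -expRM_natr -expRN; congr expR; field.
have h : 5 / 6 <= expR (- 6^-1) :> R.
  by apply: le_trans (expR_ge1Dx _); lra.
have h6 : (5 / 6) ^+ 6 <= expR (- 6^-1) ^+ 6 :> R.
  by rewrite lerXn2r ?nnegrE ?expR_ge0//; lra.
apply: (@le_trans _ _ (((5 / 6) ^+ 6)^-1)).
  by rewrite lef_pV2// posrE exprn_gt0 ?expR_gt0//; lra.
by rewrite -[leRHS]invrK lef_pV2 ?posrE ?invr_gt0 ?exprn_gt0//; lra.
Qed.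

Lemma ln3V_ge1 xi : 0 < xi <= 1 -> 1 <= ln (3 / xi).
Proof.
move=> /andP[xi0 xi1]; rewrite -[leLHS]expRK ler_ln ?posrE ?expR_gt0 ?divr_gt0//.
by apply: le_trans expR1_le3 _; rewrite ler_pdivlMr//; lra.
Qed.

(** Follows from ln x = 2 ln (sqrt x) <= 2 sqrt x. It later turns ln^delta (3 / xi) into 12 / xi for
    the second entry of the minimum. *)
Lemma ln3V_sqr_le xi : 0 < xi <= 1 -> ln (3 / xi) ^+ 2 <= 12 / xi.
Proof.
move=> xi01; have t1 := ln3V_ge1 xi01; case/andP: xi01 => xi0 xi1.
have x0 : 0 < 3 / xi by rewrite divr_gt0.
have h := @le_ln1Dx R (Num.sqrt (3 / xi) - 1).
have s0 : 0 < Num.sqrt (3 / xi) by rewrite sqrtr_gt0.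
have {h} : ln (1 + (Num.sqrt (3 / xi) - 1)) <= Num.sqrt (3 / xi) - 1 by apply: h; lra.
rewrite addrC subrK => h.
have e : ln (3 / xi) = 2 * ln (Num.sqrt (3 / xi)).
  by rewrite -{1}(sqr_sqrtr (ltW x0)) lnXn// mulr2n; ring.
have le : ln (3 / xi) <= 2 * Num.sqrt (3 / xi) by rewrite e; lra.
have -> : 12 / xi = (2 * Num.sqrt (3 / xi)) ^+ 2.
  by rewrite exprMn sqr_sqrtr ?(ltW x0)//; field; rewrite gt_eqF.
by rewrite ler_sqr ?nnegrE; lra.
Qed.

Lemma ln2_ge_half : 1 / 2 <= ln 2 :> R.
Proof.
have := @le_ln1Dx R (2^-1 - 1).
have -> : 1 + (2^-1 - 1) = 2^-1 :> R by lra.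
by rewrite lnV ?posrE// => H; have := H (ltac:(lra)); lra.
Qed.

(** Write t = ln (3 / xi). For L just above 2 t / ln 2, 2^L exceeds exp (2 t) = 9 / xi^2; since ln 2
    >= 1 / 2 and t >= 1, L <= 4 t + 1 <= 5 t. *)
Lemma exists_level xi : 0 < xi <= 1 -> exists L : nat,
  [/\ (0 < L)%N, L%:R <= 5 * ln (3 / xi) & xi ^- 2 <= 2 ^+ L].
Proof.
move=> xi01; have t1 := ln3V_ge1 xi01; case/andP: xi01 => xi0 xi1.
set t := ln _ in t1 *.
have l2 := ln2_ge_half.
have t0 : 0 <= 2 * t / ln 2 by rewrite divr_ge0; lra.
exists (Num.truncn (2 * t / ln 2)).+1.
have /andP[h1 h2] := truncn_itv t0; split=> //.
  rewrite -addn1 natrD; apply: le_trans (_ : 2 * t / ln 2 + 1 <= _); first by rewrite lerD2r.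
  have : 2 * t / ln 2 <= 4 * t by rewrite ler_pdivrMr; nra.
  lra.
set L := (Num.truncn _).+1 in h2 *.
have {}h2 : 2 * t <= L%:R * ln 2 by rewrite -ler_pdivrMr; [exact: ltW|lra].
have -> : 2 ^+ L = expR (L%:R * ln 2) :> R by rewrite expRM_natl lnK// posrE.
apply: (@le_trans _ _ (expR (2 * t))); last by rewrite ler_expR.
rewrite expRM_natl lnK ?posrE ?divr_gt0// exprMn exprVn.
by rewrite ler_peMl ?invr_ge0 ?sqr_ge0//; lra.
Qed.

(** With y = r rho^s, the term is 1 / (1 + y) - 1 / (1 + rho y) divided by rho - 1. The bound is
    free of r, which makes the estimates below uniform in xi and k. *)
Lemma telescoping_sum_le r rho (n : nat) : 0 < r -> 1 < rho ->
  \sum_(0 <= s < n) (r * rho ^+ s) / ((1 + r * rho ^+ s) * (1 + r * rho ^+ s.+1))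
    <= (rho - 1)^-1.
Proof.
move=> r0 rho1.
have e0 s : 0 < r * rho ^+ s by rewrite mulr_gt0 ?exprn_gt0//; lra.
have -> : \sum_(0 <= s < n) (r * rho ^+ s) / ((1 + r * rho ^+ s) * (1 + r * rho ^+ s.+1))
   = \sum_(0 <= s < n) (- (rho - 1)^-1 * (1 + r * rho ^+ s.+1)^-1
       - - (rho - 1)^-1 * (1 + r * rho ^+ s)^-1).
  apply: eq_bigr => s _; have := e0 s; have := e0 s.+1; rewrite exprS.
  move: (rho ^+ s) => z h1 h2; field.
  by apply/and3P; split; apply: lt0r_neq0; nra.
rewrite telescope_sumr// expr0 mulr1.
have A : 0 <= (rho - 1)^-1 * (1 + r * rho ^+ n)^-1.
  by rewrite mulr_ge0 ?invr_ge0//; [lra|have := e0 n; lra].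
have B : (rho - 1)^-1 * (1 + r)^-1 <= (rho - 1)^-1.
  by rewrite ler_piMr ?invr_ge0 ?invf_le1; lra.
by rewrite !mulNr; lra.
Qed.

(** exp (xi z / 2) >= (xi z / 12)^6 = (xi^2 z)^3 z^3 / 12^6, and xi^2 z >= 1. *)
Lemma expR_decay xi z : 0 < xi -> 0 < z -> xi ^- 2 <= z ->
  expR (- xi * z / 2) <= 12 ^+ 6 / z ^+ 3.
Proof.
move=> xi0 z0 xiz.
have h := @expR_ge_pow 5 (xi * z / 2).
have e0 : 0 < xi * z by rewrite mulr_gt0.
have {}h : (xi * z / 12) ^+ 6 <= expR (xi * z / 2).
  apply: le_trans (h _); last by lra.
  by rewrite lerXn2r ?nnegrE; lra.
have e : 1 <= xi ^+ 6 * z ^+ 3.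
  have -> : xi ^+ 6 * z ^+ 3 = (xi ^+ 2 * z) ^+ 3 by ring.
  by rewrite exprn_ege1// -(@mulVf _ (xi ^- 2)) ?invr_eq0 ?sqrf_eq0 ?gt_eqF// invrK
    ler_wpM2l// sqr_ge0.
have -> : - xi * z / 2 = - (xi * z / 2) by ring.
rewrite expRN -[leRHS]invrK lef_pV2 ?posrE ?expR_gt0 ?invr_gt0 ?divr_gt0 ?exprn_gt0//.
apply: le_trans h.
have -> : (12 ^+ 6 / z ^+ 3)^-1 = z ^+ 3 / 12 ^+ 6 by rewrite invf_div.
have -> : (xi * z / 12) ^+ 6 = (xi ^+ 6 * z ^+ 3) * (z ^+ 3 / 12 ^+ 6) by field.
by rewrite ler_peMl// divr_ge0 ?exprn_ge0// ltW.
Qed.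

(** For xi <= 1, exp (- xi) <= 1 / (1 + xi) <= 1 - xi / 2, so each term is at most the drop of (2 /
    xi) exp (- xi i) from i to i + 1. *)
Lemma sum_expR_le xi (u v : nat) : 0 < xi <= 1 ->
  \sum_(u <= i < v) expR (- xi * i%:R) <= 2 / xi * expR (- xi * u%:R).
Proof.
move=> /andP[xi0 xi1]; have [vu|uv] := leqP v u.
  by rewrite big_geq// mulr_ge0 ?expR_ge0// divr_ge0// ltW.
have h : expR (- xi) <= 1 - xi / 2.
  rewrite expRN -[leRHS]invrK lef_pV2 ?posrE ?expR_gt0 ?invr_gt0//; last by lra.
  apply: le_trans (expR_ge1Dx _); rewrite invf_ple ?posrE; try lra.
  by rewrite -[X in X <= _]mul1r ler_pdivrMr; nra.
apply: (@le_trans _ _ (\sum_(u <= i < v)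
    (- (2 / xi) * expR (- xi * i.+1%:R) - - (2 / xi) * expR (- xi * i%:R)))).
  apply: ler_sum => i _; rewrite -[in i.+1%:R]addn1 natrD mulrDr mulr1 expRD.
  have e0 : 0 < expR (- xi * i%:R) by exact: expR_gt0.
  have -> : - (2 / xi) * (expR (- xi * i%:R) * expR (- xi)) - - (2 / xi) * expR (- xi * i%:R)
     = expR (- xi * i%:R) * ((2 / xi) * (1 - expR (- xi))) by ring.
  rewrite ler_peMr ?(ltW e0)// mulrAC ler_pdivlMr//; lra.
rewrite telescope_sumr; last exact: ltnW.
have : 0 <= 2 / xi * expR (- xi * v%:R) by rewrite mulr_ge0 ?expR_ge0// divr_ge0// ltW.
by rewrite !mulNr; lra.
Qed.

Lemma sum_geometric_half (n : nat) : \sum_(0 <= s < n) (2 ^- s : R) <= 2.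
Proof.
suff -> : \sum_(0 <= s < n) (2 ^- s : R) = 2 - 2 * 2 ^- n.
  by rewrite gerBl mulr_ge0// invr_ge0 exprn_ge0.
elim: n => [|n IH]; first by rewrite big_geq// expr0; lra.
rewrite big_nat_recr//= IH exprS.
have : 2 ^+ n != 0 :> R by rewrite expf_neq0.
by move: (2 ^+ n) => z z0; field.
Qed.

Lemma sum_sqr_half (n : nat) : \sum_(0 <= l < n) ((l%:R ^+ 2 + 1) / 2 ^+ l : R) <= 8.
Proof.
suff -> : \sum_(0 <= l < n) ((l%:R ^+ 2 + 1) / 2 ^+ l : R)
    = 8 - (2 * n%:R ^+ 2 + 4 * n%:R + 8) / 2 ^+ n.
  by rewrite gerBl divr_ge0 ?exprn_ge0// !addr_ge0// mulr_ge0.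
elim: n => [|n IH]; first by rewrite big_geq// expr0; field.
rewrite big_nat_recr//= IH [2 ^+ n.+1]exprS -[n.+1%:R]natr1.
have : 2 ^+ n != 0 :> R by rewrite expf_neq0.
by move: (2 ^+ n) => z z0; field.
Qed.

Lemma sum_indicator_le (L n : nat) (x : R) : 0 <= x ->
  \sum_(0 <= s < n) (if (s < L)%N then x else 0) <= L%:R * x.
Proof.
move=> x0; rewrite -big_mkcond/= big_const_seq iter_addr_0 -[leLHS]mulr_natl.
rewrite ler_wpM2r// ler_nat -size_filter -[leqRHS](size_iota 0).
apply: uniq_leq_size; first by rewrite filter_uniq// iota_uniq.
by move=> i; rewrite mem_filter !mem_iota => /andP[-> _].
Qed.

(** * The growth function theta and the weights p_l *)

Section Theta.
Variable delta : R.
Hypotheses (delta_gt1 : 1 < delta) (delta_le2 : delta <= 2).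

Lemma theta_ge1 x : 1 <= theta delta x.
Proof.
have d1 := delta_gt1; have d2 := delta_le2.
apply: (@le_trans _ _ (1 `^ delta)); first by rewrite powR1.
have d0 : 0 <= delta by lra.
rewrite /theta ge0_ler_powR// ?nnegrE// ?le_max ?lexx//.
by rewrite ler01.
Qed.

Lemma theta_le x y : x <= y -> theta delta x <= theta delta y.
Proof.
have d1 := delta_gt1; have d2 := delta_le2.
move=> xy; have d0 : 0 <= delta by lra.
by rewrite /theta ge0_ler_powR// ?nnegrE ?ge_max ?le_max ?ler01 ?lexx ?xy ?orbT.
Qed.

Lemma powR_le_sqr x : 1 <= x -> x `^ delta <= x ^+ 2.
Proof.
have d1 := delta_gt1; have d2 := delta_le2.
by move=> x1; rewrite -powR_mulrn ?ler_powR//; lra.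
Qed.

Lemma theta_le_sqr x y : x <= y -> 1 <= y -> theta delta x <= y ^+ 2.
Proof.
have d1 := delta_gt1; have d2 := delta_le2.
move=> xy y1; apply: le_trans (theta_le xy) _.
by rewrite /theta max_r// powR_le_sqr.
Qed.

(** As theta is nondecreasing, the subtracted term is at most half of the first one. Hence p_l
    equals 1 / (theta(l) 2^l) up to a factor 2. *)
Lemma p_theta_ge l : 2^-1 / (theta delta l%:R * 2 ^+ l) <= p_theta delta l.
Proof.
have d1 := delta_gt1; have d2 := delta_le2.
have h : theta delta l%:R <= theta delta l.+1%:R by rewrite theta_le// ler_nat.
have h1 := theta_ge1 l%:R.
have h2 : 0 < 2 ^+ l :> R by rewrite exprn_gt0.
rewrite /p_theta exprS.
have : 1 / (theta delta l.+1%:R * (2 * 2 ^+ l)) <= 1 / (theta delta l%:R * (2 * 2 ^+ l)).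
  rewrite !div1r lef_pV2 ?posrE ?mulr_gt0//; try lra.
  by rewrite ler_wpM2r//; lra.
have -> : 1 / (theta delta l%:R * (2 * 2 ^+ l)) = 2^-1 / (theta delta l%:R * 2 ^+ l).
  by field; rewrite !gt_eqF//; lra.
have -> : 1 / (theta delta l%:R * 2 ^+ l) = 2 * (2^-1 / (theta delta l%:R * 2 ^+ l)).
  by field; rewrite !gt_eqF//; lra.
lra.
Qed.

Lemma p_theta_gt0 l : 0 < p_theta delta l.
Proof.
have d1 := delta_gt1; have d2 := delta_le2.
apply: lt_le_trans (p_theta_ge l); rewrite divr_gt0// mulr_gt0 ?exprn_gt0//.
by have := theta_ge1 l%:R; lra.
Qed.

Lemma p_thetaV_le l : (p_theta delta l)^-1 <= 2 * (theta delta l%:R * 2 ^+ l).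
Proof.
have d1 := delta_gt1; have d2 := delta_le2.
have h : 0 < theta delta l%:R by have := theta_ge1 l%:R; lra.
have h2 : 0 < 2 ^+ l :> R by rewrite exprn_gt0.
rewrite -[leRHS]invrK lef_pV2 ?posrE ?p_theta_gt0//; last first.
  by rewrite invr_gt0 !mulr_gt0.
by apply: le_trans (p_theta_ge l); rewrite invfM.
Qed.

Lemma p_theta_le l : p_theta delta l <= 1 / (theta delta l%:R * 2 ^+ l).
Proof.
have d1 := delta_gt1; have d2 := delta_le2.
rewrite /p_theta gerBl divr_ge0// mulr_ge0 ?exprn_ge0//.
by have := theta_ge1 l.+1%:R; lra.
Qed.

(** This is the comparison of (m + 1)^-delta with the integral of x^-delta over [m, m + 1], obtained
    from exp u >= 1 + u and ln ((m + 1) / m) >= 1 / (m + 1). *)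
Lemma invr_theta_le (m : nat) : (0 < m)%N ->
  (delta - 1) / theta delta m.+1%:R <= m%:R `^ (1 - delta) - m.+1%:R `^ (1 - delta).
Proof.
have d1 := delta_gt1; have d2 := delta_le2.
move=> m0; have m0' : 0 < m%:R :> R by rewrite ltr0n.
have m1 : 0 < m.+1%:R :> R by rewrite ltr0n.
rewrite /theta max_r ?ler1n//.
have -> : m.+1%:R `^ delta = m.+1%:R / m.+1%:R `^ (1 - delta).
  rewrite -powRN -{2}(powRr1 (ltW m1)) -powRD; last by rewrite (gt_eqF m1) implybT.
  by congr (_ `^ _); ring.
have -> : m%:R `^ (1 - delta) =
    m.+1%:R `^ (1 - delta) * (m.+1%:R / m%:R) `^ (delta - 1).
  rewrite powRM ?invr_ge0 ?(ltW m0')// -powR_inv1 ?(ltW m0')// -powRrM mulrA -powRD; last first.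
    by rewrite (gt_eqF m1) implybT.
  have -> : 1 - delta + (delta - 1) = 0 by ring.
  by rewrite powRr0 mul1r; congr (_ `^ _); ring.
set T := m.+1%:R `^ (1 - delta).
have T0 : 0 < T by rewrite powR_gt0.
have -> : (delta - 1) / (m.+1%:R / T) = T * ((delta - 1) / m.+1%:R).
  by field; rewrite !gt_eqF.
rewrite [leRHS](_ : _ = T * ((m.+1%:R / m%:R) `^ (delta - 1) - 1)); last by ring.
rewrite ler_wpM2l ?(ltW T0)//.
rewrite /powR gt_eqF ?divr_gt0//.
apply: (@le_trans _ _ ((delta - 1) * ln (m.+1%:R / m%:R))); last first.
  by have := expR_ge1Dx ((delta - 1) * ln (m.+1%:R / m%:R)); lra.
rewrite ler_wpM2l//; first by lra.
have -> : m.+1%:R / m%:R = (m%:R / m.+1%:R)^-1 :> R by rewrite invf_div.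
rewrite lnV ?posrE ?divr_gt0//.
have := @le_ln1Dx R (m%:R / m.+1%:R - 1).
have -> : m%:R / m.+1%:R - 1 = - m.+1%:R^-1 :> R.
  by rewrite -[m.+1]addn1 natrD; field; rewrite -natr1 in m1; rewrite gt_eqF// natr1.
move=> h.
have {}h : ln (1 - m.+1%:R^-1) <= - m.+1%:R^-1 :> R.
  by apply: h; rewrite ltrN2 invf_lt1// ltr1n ltnS.
have -> : m%:R / m.+1%:R = 1 - m.+1%:R^-1 :> R.
  by rewrite -[m.+1]addn1 natrD; field; rewrite -natr1 in m1; rewrite gt_eqF// natr1.
by rewrite lerNr.
Qed.

Lemma sum_invr_theta_le (n : nat) :
  \sum_(0 <= l < n) (1 / theta delta l%:R) <= 3 / (delta - 1).
Proof.
have d1 := delta_gt1; have d2 := delta_le2.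
have d3 : 0 < delta - 1 by lra.
have tp l : 0 <= 1 / theta delta l%:R by rewrite divr_ge0//; have := theta_ge1 l%:R; lra.
have t1 l : 1 / theta delta l%:R <= 1.
  by rewrite div1r invf_le1 ?theta_ge1//; have := theta_ge1 l%:R; lra.
(* The terms l = 0 and l = 1 are each at most 1 and the others telescope; delta - 1 <= 1 then
   absorbs the 2 into 3 / (delta - 1). *)
suff H m : \sum_(0 <= l < m.+2) (1 / theta delta l%:R) <=
    2 + (1 - m.+1%:R `^ (1 - delta)) / (delta - 1).
  apply: (@le_trans _ _ (\sum_(0 <= l < n.+2) (1 / theta delta l%:R))).
    by rewrite !big_nat_recr//= -addrA lerDl addr_ge0.
  apply: le_trans (H n) _.
  apply: (@le_trans _ _ (2 + 1 / (delta - 1))).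
    rewrite lerD2l ler_wpM2r ?invr_ge0 ?(ltW d3)// gerBl; exact: powR_ge0.
  by rewrite ler_pdivlMr// mulrDl divfK ?gt_eqF//; lra.
elim: m => [|m IH].
  by rewrite !big_nat_recr//= big_geq// powR1 subrr mul0r; have := t1 0%N; have := t1 1%N; lra.
rewrite big_nat_recr//=.
have h := @invr_theta_le m.+1 isT.
have {}h : 1 / theta delta m.+2%:R <=
   (m.+1%:R `^ (1 - delta) - m.+2%:R `^ (1 - delta)) / (delta - 1).
  by rewrite ler_pdivlMr// mulrAC mul1r.
apply: le_trans (lerD IH h) _.
by rewrite le_eqVlt; apply/orP; left; apply/eqP; field; rewrite gt_eqF.
Qed.

End Theta.
End RealBounds.

(** * Independence and laws *)

Section GeneratedIndependence.
Context d (Omega : measurableType d) (R : realType) (P : probability Omega R).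

(** In A, both sides are finite measures; they agree on the pi-system [G], hence on the
    sigma-algebra it generates. [G setT] supplies the exhausting sequence, which is constant. *)
Lemma indep_g_sigma (G : set (set Omega)) (B : set Omega) :
  G `<=` measurable -> setI_closed G -> G setT -> measurable B ->
  (forall A, G A -> P (A `&` B) = (P A * P B)%E) ->
  forall A, <<s G >> A -> P (A `&` B) = (P A * P B)%E.
Proof.
move=> Gm GI GT mB PG A sA.
have B0 : 0 <= fine (P B) by rewrite fine_ge0.
have PB : (P B = (fine (P B))%:E)%E by rewrite fineK// fin_num_measure.
have cov : \bigcup_(k : nat) (setT : set Omega) = setT by rewrite bigcup_const//; exists 0%N.
have H := @g_sigma_algebra_measure_unique _ _ _ G Gm (fun=> setT) (fun=> GT) cov
  (mrestr P mB)
  (mscale (NngNum B0) P) GI.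
have E C : mscale (NngNum B0) P C = (P C * P B)%E.
  by rewrite /mscale/= -PB muleC.
rewrite -E -[LHS]/(mrestr P mB A); apply: H => //.
- by move=> C GC; rewrite [RHS]E [LHS]/(mrestr P mB C) /mrestr PG.
- by move=> _; rewrite [X in (X < _)%E]/(mrestr P mB setT) /mrestr setTI PB ltry.
Qed.

Lemma indep_g_sigma2 (G1 G2 : set (set Omega)) :
  G1 `<=` measurable -> setI_closed G1 -> G1 setT ->
  G2 `<=` measurable -> setI_closed G2 -> G2 setT ->
  (forall A B, G1 A -> G2 B -> P (A `&` B) = (P A * P B)%E) ->
  forall A B, <<s G1 >> A -> <<s G2 >> B -> P (A `&` B) = (P A * P B)%E.
Proof.
move=> G1m G1I G1T G2m G2I G2T PG A B sA sB.
have mA : measurable A.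
  by move: A sA; apply: smallest_sub => //; exact: sigma_algebra_measurable.
rewrite setIC muleC.
apply: (indep_g_sigma G2m G2I G2T mA) => // C GC.
have mC := G2m _ GC.
rewrite setIC muleC.
by apply: (indep_g_sigma G1m G1I G1T mC) => // D GD; exact: PG.
Qed.

End GeneratedIndependence.

Section FamilyIndependence.
Context d (Omega : measurableType d) (R : realType) (P : probability Omega R).
Context (I : choiceType) d' (T : measurableType d') (X : I -> {RV P >-> T}).

Definition gens (S : set I) : set (set Omega) :=
  \bigcup_(i in S) preimage_set_system setT (X i : Omega -> T) measurable.

(** [gens S] generates the sigma-algebra of the X_i with i in S, but is not stable under
    intersection; the finite cylinders form a pi-system that contains it. *)
Definition cylinders (S : set I) : set (set Omega) :=
  [set A | exists J : {fset I}, exists2 B : I -> set T,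
     (forall i, measurable (B i)) &
     [set` J] `<=` S /\ A = \bigcap_(i in [set` J]) X i @^-1` B i].

Lemma measurable_gens S : gens S `<=` measurable.
Proof.
move=> A [i _ [B mB <-]]; rewrite setTI.
by rewrite -[_ @^-1` _]setTI; exact: measurable_funP.
Qed.

Lemma measurable_cylinders S : cylinders S `<=` measurable.
Proof.
move=> A [J [B mB [_ ->]]].
apply: fin_bigcap_measurable => // i _.
by rewrite -[_ @^-1` _]setTI; exact: measurable_funP.
Qed.

Lemma cylindersT S : cylinders S setT.
Proof.
exists fset0, (fun=> setT) => //; split; first by move=> i.
by apply/seteqP; split.
Qed.

(** Padding each family with the full set outside its own index set lets one family, indexed by the
    union, describe both intersections. *)
Lemma bigcap_cylinders (J1 J2 : {fset I}) (B1 B2 : I -> set T) :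
  (\bigcap_(i in [set` J1]) X i @^-1` B1 i) `&`
  (\bigcap_(i in [set` J2]) X i @^-1` B2 i) =
  \bigcap_(i in [set` (J1 `|` J2)%fset]) X i @^-1`
    ((if i \in J1 then B1 i else setT) `&`
     (if i \in J2 then B2 i else setT)).
Proof.
apply/seteqP; split=> w /=.
  move=> [h1 h2] i /= _; split.
    by case: ifPn => // iJ; exact: (h1 i).
  by case: ifPn => // iJ; exact: (h2 i).
move=> h; split=> i /= iJ.
  by have [|] := h i; rewrite /= ?inE ?iJ.
by have [|] := h i; rewrite /= ?inE ?iJ ?orbT.
Qed.

Lemma setI_closed_cylinders S : setI_closed (cylinders S).
Proof.
move=> _ _ [J1 [B1 mB1 [JS1 ->]]] [J2 [B2 mB2 [JS2 ->]]].
exists (J1 `|` J2)%fset; rewrite bigcap_cylinders.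
eexists; last by split; [|reflexivity]; move=> i /=; rewrite inE => /orP[/JS1|/JS2].
by move=> i; apply: measurableI; case: ifP.
Qed.

Lemma gens_cylinders S : gens S `<=` cylinders S.
Proof.
move=> A [i Si [B mB <-]].
exists [fset i]%fset, (fun=> B) => //; split.
  by move=> j /=; rewrite inE => /eqP ->.
rewrite setTI; apply/seteqP; split=> w /=; first by
  move=> ? j /=; rewrite inE => /eqP ->.
by apply; rewrite /= inE.
Qed.

(** For cylinders over disjoint index sets, the product of probabilities over the union splits into
    two products; the pi-system argument extends this to the sigma-algebras. *)
Lemma mutually_independent_gens (S1 S2 : set I) :
  mutually_independent P (fun i => X i : Omega -> T) -> S1 `&` S2 = set0 ->
  forall A B, <<s gens S1 >> A -> <<s gens S2 >> B ->
  P (A `&` B) = (P A * P B)%E.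
Proof.
move=> indX S12 A B sA sB.
have PC : forall C D, cylinders S1 C -> cylinders S2 D ->
    P (C `&` D) = (P C * P D)%E; last first.
  apply: (@indep_g_sigma2 _ _ _ P (cylinders S1) (cylinders S2)) => //;
    try exact: measurable_cylinders; try exact: setI_closed_cylinders;
  try exact: cylindersT.
  - by move: A sA; apply: sub_sigma_algebra2; exact: gens_cylinders.
  - by move: B sB; apply: sub_sigma_algebra2; exact: gens_cylinders.
move=> {A B sA sB} _ _ [J1 [B1 mB1 [JS1 ->]]] [J2 [B2 mB2 [JS2 ->]]].
rewrite bigcap_cylinders !indX//; last first.
  by move=> i; apply: measurableI; case: ifP.
have dJ : [disjoint J1 & J2]%fset.
  apply/fdisjointP => i iJ1; apply/negP => iJ2.
  by have [] : set0 i by rewrite -S12; split; [exact: JS1|exact: JS2].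
rewrite (perm_big (J1 ++ J2)) /=; last first.
  apply: uniq_perm; rewrite ?fset_uniq// ?cat_uniq ?fset_uniq ?andbT//=.
    apply/hasPn => i iJ2; apply/negP => iJ1.
    by move/fdisjointP : dJ => /(_ _ iJ1); rewrite iJ2.
  by move=> i; rewrite mem_cat inE.
rewrite big_cat/=; congr (_ * _)%E; apply: eq_big_seq => i iJ; rewrite iJ.
  suff /negPf -> : i \notin J2 by rewrite setIT.
  by move/fdisjointP : dJ => /(_ _ iJ).
suff /negPf -> : i \notin J1 by rewrite setTI.
by apply/negP => iJ1; move/fdisjointP : dJ => /(_ _ iJ1); rewrite iJ.
Qed.

End FamilyIndependence.

Section Laws.
Context d (Omega : measurableType d) (R : realType) (P : probability Omega R).

Lemma same_law_ge0_integral d1 (T : measurableType d1) (X Y : Omega -> T)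
    (phi : T -> \bar R) :
  measurable_fun setT X -> measurable_fun setT Y ->
  same_law P X Y -> measurable_fun setT phi -> (forall x, (0 <= phi x)%E) ->
  (\int[P]_w phi (X w) = \int[P]_w phi (Y w))%E.
Proof.
move=> mX mY XY mphi phi0.
pose X' : {RV P >-> T} := mfun_Sub (mem_set mX).
pose Y' : {RV P >-> T} := mfun_Sub (mem_set mY).
rewrite -[LHS](ge0_integral_distribution X' mphi phi0).
rewrite -[RHS](ge0_integral_distribution Y' mphi phi0).
by apply: eq_measure_integral => A mA _; exact: XY.
Qed.

Lemma independent_distribution d1 d2 (T1 : measurableType d1)
    (T2 : measurableType d2) (X : {RV P >-> T1}) (Y : {RV P >-> T2}) :
  independent_rv P X Y -> forall C, measurable C ->
  P ((fun w => (X w, Y w)) @^-1` C) = (distribution P X \x distribution P Y)%E C.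
Proof.
move=> iXY C mC.
have mXY : measurable_fun setT (fun w => (X w, Y w)) by exact: measurable_fun_pair.
pose XY : {RV P >-> (T1 * T2)%type} := mfun_Sub (mem_set mXY).
by rewrite (@product_measure_unique _ _ _ _ _ (distribution P X)
  (distribution P Y) (distribution P XY)).
Qed.

Lemma same_law_pair d1 d2 (T1 : measurableType d1) (T2 : measurableType d2)
    (X X' : Omega -> T1) (Y Y' : Omega -> T2) :
  measurable_fun setT X -> measurable_fun setT X' ->
  measurable_fun setT Y -> measurable_fun setT Y' ->
  independent_rv P X Y -> independent_rv P X' Y' ->
  same_law P X X' -> same_law P Y Y' ->
  same_law P (fun w => (X w, Y w)) (fun w => (X' w, Y' w)).
Proof.
move=> mX mX' mY mY' iXY iXY' sX sY C mC.
pose V : {RV P >-> T1} := mfun_Sub (mem_set mX).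
pose V' : {RV P >-> T1} := mfun_Sub (mem_set mX').
pose W : {RV P >-> T2} := mfun_Sub (mem_set mY).
pose W' : {RV P >-> T2} := mfun_Sub (mem_set mY').
have mVW' : measurable_fun setT (fun w => (V' w, W' w)).
  exact: measurable_fun_pair.
pose VW' : {RV P >-> (T1 * T2)%type} := mfun_Sub (mem_set mVW').
rewrite [LHS](@independent_distribution _ _ _ _ V W)//.
rewrite (@product_measure_unique _ _ _ _ _ (distribution P V)
    (distribution P W) (distribution P VW'))// => A B mA mB.
rewrite -[LHS]/(P (X' @^-1` A `&` Y' @^-1` B)) iXY'//.
by rewrite -[RHS]/(P (X @^-1` A) * P (Y @^-1` B))%E sX// sY.
Qed.

(** Fubini on the product of the two laws, which by independence is the law of the pair. *)
Lemma independent_mean_prod (X Y : Omega -> R) :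
  independent_rv P X Y ->
  P.-integrable setT (EFin \o X) -> P.-integrable setT (EFin \o Y) ->
  P.-integrable setT (EFin \o (fun w => X w * Y w)) ->
  \int[P]_w (X w * Y w) = \int[P]_w X w * \int[P]_w Y w.
Proof.
move=> iXY intX intY intXY.
have mX : measurable_fun setT X.
  by apply/measurable_EFinP; exact: measurable_int intX.
have mY : measurable_fun setT Y.
  by apply/measurable_EFinP; exact: measurable_int intY.
pose V : {RV P >-> R} := mfun_Sub (mem_set mX).
pose W : {RV P >-> R} := mfun_Sub (mem_set mY).
have mVW : measurable_fun setT (fun w => (V w, W w)) by exact: measurable_fun_pair.
pose VW : {RV P >-> (R * R)%type} := mfun_Sub (mem_set mVW).
pose h := fun z : (R * R)%type => (z.1 * z.2)%:E.
have mh : measurable_fun setT h.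
  by apply/measurable_EFinP/measurable_funM;
    [exact: measurable_fst|exact: measurable_snd].
have lawVW A : measurable A ->
    (distribution P V \x distribution P W)%E A = distribution P VW A.
  by move=> mA; rewrite -[LHS](@independent_distribution _ _ _ _ V W).
have inth : (distribution P V \x distribution P W)%E.-integrable setT h.
  apply/integrableP; split=> //.
  rewrite (eq_measure_integral (distribution P VW)); last first.
    by move=> A mA _; exact: lawVW.
  rewrite ge0_integral_distribution//; last exact: measurableT_comp.
  by case/integrableP : intXY.
rewrite /Rintegral.
have -> : (\int[P]_w (X w * Y w)%:E = \int[distribution P VW]_z h z)%E.
  by rewrite integral_distribution.
rewrite (eq_measure_integral (distribution P V \x distribution P W)%E); last first.
  by move=> A mA _; apply/esym; exact: lawVW.
rewrite -integral12_prod_meas1//.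
have EW : (\int[distribution P W]_y y%:E = (\int[P]_w Y w)%:E)%E.
  rewrite (integral_distribution (X := W) (f := EFin))//.
  by rewrite fineK//; exact: integrable_fin_num.
have EV : (\int[distribution P V]_y y%:E = (\int[P]_w X w)%:E)%E.
  rewrite (integral_distribution (X := V) (f := EFin))//.
  by rewrite fineK//; exact: integrable_fin_num.
have iV : (distribution P V).-integrable setT EFin by apply: integrable_pushforward.
have iW : (distribution P W).-integrable setT EFin by apply: integrable_pushforward.
rewrite (eq_integral (fun x : R => (x%:E * (\int[P]_w Y w)%:E)%E)); last first.
  by move=> x _; rewrite /h -EW -integralZl.
by rewrite integralZr// EV.
Qed.

(** A criterion in terms of a nonnegative integral lets square-integrability pass between variables
    of the same law through [same_law_ge0_integral]. *)
Lemma Lfun2P (X : Omega -> R) : X \in Lfun P 2%:E <->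
  measurable_fun setT X /\ (\int[P]_w (X w ^+ 2)%:E < +oo)%E.
Proof.
split=> [LX|[mX IX]].
  split; first by have := sub_Lfun_mfun LX; rewrite inE.
  have /integrableP[_] := Lfun2_integrable_sqr LX; apply: le_lt_trans.
  rewrite ge0_le_integral//.
  - by move=> w _; rewrite lee_fin sqr_ge0.
  - apply/measurable_EFinP/measurable_funX.
    by have := sub_Lfun_mfun LX; rewrite inE.
  - apply: measurableT_comp => //; apply/measurable_EFinP/measurable_funX.
    by have := sub_Lfun_mfun LX; rewrite inE.
  - by move=> w _ /=; rewrite lee_fin ler_norm.
rewrite inE; apply/andP; split; rewrite inE//=.
rewrite /finite_norm unlock /=.
apply: poweR_lty; apply: le_lt_trans IX.
rewrite ge0_le_integral//.
- apply/measurable_EFinP.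
  apply/(@measurableT_comp _ _ _ _ _ _ (fun x : R => x `^ 2)%R) => //.
  exact/measurableT_comp.
- exact/measurable_EFinP/measurable_funX.
- by move=> w _; rewrite lee_fin powR_mulrn// real_normK// num_real.
Qed.

Lemma same_law_comp d1 d2 (T1 : measurableType d1) (T2 : measurableType d2)
    (X X' : Omega -> T1) (h : T1 -> T2) :
  measurable_fun setT h -> same_law P X X' -> same_law P (h \o X) (h \o X').
Proof.
move=> mh sX B mB; have := sX (h @^-1` B); apply.
by rewrite -[_ @^-1` _]setTI; exact: mh.
Qed.

Lemma independent_rv_comp d1 d2 d3 d4 (T1 : measurableType d1)
    (T2 : measurableType d2) (T3 : measurableType d3) (T4 : measurableType d4)
    (X : Omega -> T1) (Y : Omega -> T2) (h : T1 -> T3) (k : T2 -> T4) :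
  measurable_fun setT h -> measurable_fun setT k ->
  independent_rv P X Y -> independent_rv P (h \o X) (k \o Y).
Proof.
move=> mh mk iXY A B mA mB; apply: (iXY (h @^-1` A) (k @^-1` B)).
  by rewrite -[_ @^-1` _]setTI; exact: mh.
by rewrite -[_ @^-1` _]setTI; exact: mk.
Qed.

End Laws.

(** * The restarted chains *)

Section Adapted.
Context d (Omega : measurableType d) (R : realType) (P : probability Omega R).
Context (I : choiceType) d' (T : measurableType d') (U : I -> {RV P >-> T}).

Lemma measurable_gens_sub (S : set I) d1 (T1 : measurableType d1)
    (X : Omega -> T1) :
  measurable_fun (setT : set (g_sigma_algebraType (gens U S))) X ->
  measurable_fun setT X.
Proof.
move=> mX _ B mB; have := mX measurableT B mB.
move: (setT `&` _); apply: smallest_sub; last exact: measurable_gens.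
exact: sigma_algebra_measurable.
Qed.

Lemma measurable_gens_coord (S : set I) i : S i ->
  measurable_fun (setT : set (g_sigma_algebraType (gens U S))) (U i).
Proof.
move=> Si _ B mB; apply: sub_sigma_algebra.
by exists i => //; exists B.
Qed.

Lemma independent_gens (S1 S2 : set I) d1 d2 (T1 : measurableType d1)
    (T2 : measurableType d2) (X : Omega -> T1) (Y : Omega -> T2) :
  mutually_independent P (fun i => U i : Omega -> T) -> S1 `&` S2 = set0 ->
  measurable_fun (setT : set (g_sigma_algebraType (gens U S1))) X ->
  measurable_fun (setT : set (g_sigma_algebraType (gens U S2))) Y ->
  independent_rv P X Y.
Proof.
move=> indU S12 mX mY A B mA mB.
apply: (mutually_independent_gens indU S12).
  by have := mX measurableT A mA; rewrite setTI.
by have := mY measurableT B mB; rewrite setTI.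
Qed.

End Adapted.

Section Run.
Context d (Omega : measurableType d) (R : realType) (P : probability Omega R).
Context dF dF' (F : measurableType dF) (F' : measurableType dF').
Variables (g : F * F' -> F) (U : int -> {RV P >-> F'}) (X0 : F).
Hypothesis mg : measurable_fun setT g.
Hypothesis iidU : iid P (fun i : int => U i : Omega -> F').

(** Indexed by start time and number of steps instead of the pair (i, m), so that a shift of time
    changes [a] alone. *)
Definition run (a : int) (n : nat) : Omega -> F :=
  driven g X0 (fun t => U (t%:Z + a) : Omega -> F') n.

Lemma chain_fromE (i m : int) :
  chain_from g X0 U i m = run (- m) (absz (i + m)).
Proof. by []. Qed.

Lemma chainE (i : nat) : chain g X0 U i = run 0 i.
Proof.
rewrite /chain /run; apply/funext => w.
by congr (driven _ _ _ i w); apply/funext => n; rewrite addr0.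
Qed.

Lemma runS a n : run a n.+1 = g \o (fun w => (run a n w, U (n%:Z + a) w)).
Proof. by []. Qed.

Definition itvz (a : int) (n : nat) : set int :=
  [set i | a <= i /\ i < a + n%:Z].

Lemma measurable_run_gens (S : set int) a n : itvz a n `<=` S ->
  measurable_fun (setT : set (g_sigma_algebraType (gens U S))) (run a n).
Proof.
elim: n => [|n IH] aS; first exact: measurable_cst.
rewrite runS; apply: measurableT_comp => //.
apply: measurable_fun_pair.
  by apply: IH => i [ai ian]; apply: aS; split => //; lia.
by apply: measurable_gens_coord; apply: aS; split; lia.
Qed.

Lemma measurable_run a n : measurable_fun setT (run a n).
Proof.
by apply: (@measurable_gens_sub _ _ _ _ _ _ _ U (itvz a n)); exact: measurable_run_gens.
Qed.

(** X is a function of the U_j with j in S, hence independent of U_i, and the law of (X, U_i) is the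
    product of the law of X and the common law of the innovations. This is the induction step of
    both shift-invariance lemmas below. *)
Lemma same_law_step d1 (T1 : measurableType d1) (h : T1 * F' -> T1)
    (S S' : set int) (i i' : int) (X X' : Omega -> T1) :
  measurable_fun setT h -> ~ S i -> ~ S' i' ->
  measurable_fun (setT : set (g_sigma_algebraType (gens U S))) X ->
  measurable_fun (setT : set (g_sigma_algebraType (gens U S'))) X' ->
  same_law P X X' ->
  same_law P (fun w => h (X w, U i w)) (fun w => h (X' w, U i' w)).
Proof.
move=> mh Si Si' mX mX' sX.
have ind (V : set int) (j : int) (Y : Omega -> T1) : ~ V j ->
    measurable_fun (setT : set (g_sigma_algebraType (gens U V))) Y ->
    independent_rv P Y (U j).
  move=> Vj mY; apply: (@independent_gens _ _ _ _ _ _ _ U V [set j]) => //.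
  - by case: iidU.
  - by apply/seteqP; split => // k /= [Vk kj]; apply: Vj; rewrite -kj.
  - exact: measurable_gens_coord.
apply: (same_law_comp (h := h)) => //.
apply: same_law_pair => //.
- exact: measurable_gens_sub mX.
- exact: measurable_gens_sub mX'.
- exact: ind mX.
- exact: ind mX'.
- by case: iidU => _; exact.
Qed.

Lemma same_law_run a a' n : same_law P (run a n) (run a' n).
Proof.
elim: n => [//|n IH].
by apply: (same_law_step (S := itvz a n) (S' := itvz a' n)) => //;
  try (exact: measurable_run_gens); move=> []; lia.
Qed.

Lemma same_law_run2 a a' m n :
  same_law P (fun w => (run a (m + n)%N w, run (a + m%:Z) n w))
             (fun w => (run a' (m + n)%N w, run (a' + m%:Z) n w)).
Proof.
elim: n => [|n IH].
  rewrite addn0.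
  apply: (same_law_comp (h := fun x => (x, X0))); last exact: same_law_run.
  by apply: measurable_fun_pair => //; exact: measurable_cst.
(* Once both chains run they share each innovation, so the pair is itself a driven chain on F *
   F. *)
pose h := fun z : (F * F) * F' => (g (z.1.1, z.2), g (z.1.2, z.2)).
have mh : measurable_fun setT h.
  apply: measurable_fun_pair; apply: measurableT_comp => //;
    apply: measurable_fun_pair => //; apply: measurableT_comp => //.
have E b : (fun w => (run b (m + n.+1)%N w, run (b + m%:Z) n.+1 w)) =
  (fun w => h ((run b (m + n)%N w, run (b + m%:Z) n w), U ((m + n)%:Z + b) w)).
  apply/funext => w; rewrite addnS !runS /h /=.
  by have -> : n%:Z + (b + m%:Z) = (m + n)%:Z + b by lia.
rewrite !E.
apply: (same_law_step (S := itvz a (m + n)) (S' := itvz a' (m + n))) => //;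
  try (by move=> []; lia);
  by apply: measurable_fun_pair; apply: measurable_run_gens => // i [] *; split; lia.
Qed.

End Run.

(** * Means and second moments *)

Section SecondMoments.
Context d (Omega : measurableType d) (R : realType) (P : probability Omega R).
Implicit Types X Y : Omega -> R.

(** Real-valued, so that moment identities are within reach of [ring] and [lra]. An infinite
    integral is sent to 0, whence the integrability premises below. *)
Definition mean X : R := \int[P]_w X w.
Definition centered X : Omega -> R := fun w => X w - mean X.

Lemma Lfun2_integrable X : X \in Lfun P 2%:E -> P.-integrable setT (EFin \o X).
Proof.
move=> LX; apply/Lfun1_integrable.
by apply: Lfun_subset12 => //; rewrite fin_num_measure.
Qed.

Lemma Lfun2_integrableM X Y : X \in Lfun P 2%:E -> Y \in Lfun P 2%:E ->
  P.-integrable setT (EFin \o (fun w => X w * Y w)).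
Proof. by move=> LX LY; apply/Lfun1_integrable; exact: Lfun2_mul_Lfun1. Qed.

Lemma Lfun2D X Y : X \in Lfun P 2%:E -> Y \in Lfun P 2%:E ->
  (fun w => X w + Y w) \in Lfun P 2%:E.
Proof. by move=> LX LY; rewrite -[fun w => _]/(X \+ Y) rpredD//= lee1n. Qed.

Lemma Lfun2B X Y : X \in Lfun P 2%:E -> Y \in Lfun P 2%:E ->
  (fun w => X w - Y w) \in Lfun P 2%:E.
Proof. by move=> LX LY; rewrite -[fun w => _]/(X \- Y) rpredB//= lee1n. Qed.

Lemma Lfun2Z (a : R) X : X \in Lfun P 2%:E -> (fun w => a * X w) \in Lfun P 2%:E.
Proof.
move=> LX; rewrite (_ : (fun _ => _) = a \o* X) ?Lfun_scale ?ler1n//.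
by apply/funext => w; rewrite /= mulrC.
Qed.

Lemma Lfun2_cst (a : R) : (fun=> a) \in Lfun P 2%:E.
Proof. exact: Lfun_cst. Qed.

Lemma Lfun2_centered X : X \in Lfun P 2%:E -> centered X \in Lfun P 2%:E.
Proof. by move=> LX; apply: Lfun2B => //; exact: Lfun2_cst. Qed.

Lemma Lfun2_sum (I : Type) (s : seq I) (F : I -> Omega -> R) :
  (forall i, F i \in Lfun P 2%:E) -> (fun w => \sum_(i <- s) F i w) \in Lfun P 2%:E.
Proof.
move=> LF; elim: s => [|i s IH].
  by rewrite (_ : (fun _ => _) = fun=> 0) ?Lfun2_cst//; apply/funext => w; rewrite big_nil.
rewrite (_ : (fun _ => _) = fun w => F i w + \sum_(j <- s) F j w).
  exact: Lfun2D.
by apply/funext => w; rewrite big_cons.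
Qed.

Lemma mean_cst (a : R) : mean (fun=> a) = a.
Proof.
by rewrite /mean Rintegral_cst//= (@probability_setT _ _ _ P) /= mulr1.
Qed.

Lemma meanD X Y : P.-integrable setT (EFin \o X) -> P.-integrable setT (EFin \o Y) ->
  mean (fun w => X w + Y w) = mean X + mean Y.
Proof. by move=> iX iY; exact: (RintegralD measurableT iX iY). Qed.

Lemma meanB X Y : P.-integrable setT (EFin \o X) -> P.-integrable setT (EFin \o Y) ->
  mean (fun w => X w - Y w) = mean X - mean Y.
Proof. by move=> iX iY; exact: (RintegralB measurableT iX iY). Qed.

Lemma meanZ (a : R) X : P.-integrable setT (EFin \o X) ->
  mean (fun w => a * X w) = a * mean X.
Proof. by move=> iX; rewrite /mean RintegralZl. Qed.

Lemma integrable_cstEFin (a : R) : P.-integrable setT (EFin \o (fun=> a)).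
Proof. exact/Lfun2_integrable/Lfun2_cst. Qed.

Lemma integrableDEFin X Y :
  P.-integrable setT (EFin \o X) -> P.-integrable setT (EFin \o Y) ->
  P.-integrable setT (EFin \o (fun w => X w + Y w)).
Proof. by move=> iX iY; apply: (integrableD measurableT iX iY). Qed.

Lemma integrable_sumEFin (I : Type) (s : seq I) (F : I -> Omega -> R) :
  (forall i, P.-integrable setT (EFin \o F i)) ->
  P.-integrable setT (EFin \o (fun w => \sum_(i <- s) F i w)).
Proof.
move=> iF; elim: s => [|i s IH].
  rewrite (_ : (fun _ => _) = fun=> 0); first exact: integrable_cstEFin.
  by apply/funext => w; rewrite big_nil.
rewrite (_ : (fun _ => _) = fun w => F i w + \sum_(j <- s) F j w).
  exact: integrableDEFin.
by apply/funext => w; rewrite big_cons.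
Qed.

Lemma mean_sum (I : Type) (s : seq I) (F : I -> Omega -> R) :
  (forall i, P.-integrable setT (EFin \o F i)) ->
  mean (fun w => \sum_(i <- s) F i w) = \sum_(i <- s) mean (F i).
Proof.
move=> iF; elim: s => [|i s IH].
  by rewrite big_nil -[RHS]mean_cst; congr mean; apply/funext => w; rewrite big_nil.
rewrite big_cons -IH -meanD//; last exact: integrable_sumEFin.
by congr mean; apply/funext => w; rewrite big_cons.
Qed.

Lemma le_mean X Y : P.-integrable setT (EFin \o X) -> P.-integrable setT (EFin \o Y) ->
  (forall w, X w <= Y w) -> mean X <= mean Y.
Proof. by move=> iX iY XY; apply: le_Rintegral. Qed.

Lemma Lfun2_integrableX X : X \in Lfun P 2%:E ->
  P.-integrable setT (EFin \o (fun w => X w ^+ 2)).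
Proof. exact: Lfun2_integrable_sqr. Qed.

Lemma integrableZEFin (a : R) X : P.-integrable setT (EFin \o X) ->
  P.-integrable setT (EFin \o (fun w => a * X w)).
Proof. by move=> iX; apply: (integrableZl measurableT a iX). Qed.

Lemma mean_ge0 X : (forall w, 0 <= X w) -> 0 <= mean X.
Proof. by move=> X0; exact: Rintegral_ge0. Qed.

Lemma mean_centered X : P.-integrable setT (EFin \o X) -> mean (centered X) = 0.
Proof.
move=> iX; rewrite /centered meanB//; last exact: integrable_cstEFin.
by rewrite mean_cst subrr.
Qed.

Lemma mean_centered_sqr X : X \in Lfun P 2%:E ->
  mean (fun w => centered X w ^+ 2) = mean (fun w => X w ^+ 2) - mean X ^+ 2.
Proof.
move=> LX; have iX := Lfun2_integrable LX; have iX2 := Lfun2_integrableX LX.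
transitivity (mean (fun w => X w ^+ 2 + ((- 2 * mean X) * X w + mean X ^+ 2))).
  by congr mean; apply/funext => w; rewrite /centered; ring.
have iZ : P.-integrable setT (EFin \o (fun w => (- 2 * mean X) * X w)).
  exact: integrableZEFin.
have iC := integrable_cstEFin (mean X ^+ 2).
rewrite meanD//; last exact: integrableDEFin.
by rewrite meanD// meanZ// mean_cst; ring.
Qed.

Lemma mean_centered_sqr_le X : X \in Lfun P 2%:E ->
  mean (fun w => centered X w ^+ 2) <= mean (fun w => X w ^+ 2).
Proof. by move=> /mean_centered_sqr ->; rewrite lerBlDr lerDl sqr_ge0. Qed.

Lemma varianceE_mean X : X \in Lfun P 2%:E ->
  'V_P[X] = (mean (fun w => centered X w ^+ 2))%:E.
Proof.
move=> LX; rewrite varianceE// mean_centered_sqr// EFinB EFin_expe.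
rewrite unlock /mean /Rintegral !fineK//; apply: integrable_fin_num => //.
- exact: Lfun2_integrable.
- exact: Lfun2_integrableX.
Qed.

Lemma centered_sum (I : Type) (s : seq I) (F : I -> Omega -> R) :
  (forall i, F i \in Lfun P 2%:E) ->
  centered (fun w => \sum_(i <- s) F i w) = fun w => \sum_(i <- s) centered (F i) w.
Proof.
move=> LF; apply/funext => w; rewrite /centered mean_sum ?sumrB//.
by move=> i; exact: Lfun2_integrable.
Qed.

Lemma centeredZ (a : R) X : X \in Lfun P 2%:E ->
  centered (fun w => a * X w) = fun w => a * centered X w.
Proof.
move=> LX; apply/funext => w; rewrite /centered meanZ ?mulrBr//.
exact: Lfun2_integrable.
Qed.

Lemma centeredD_cst (a : R) X : X \in Lfun P 2%:E ->
  centered (fun w => X w + a) = centered X.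
Proof.
move=> LX; apply/funext => w; rewrite /centered meanD ?mean_cst; first by ring.
  exact: Lfun2_integrable.
exact: integrable_cstEFin.
Qed.

Lemma independent_mean_centeredM X Y : X \in Lfun P 2%:E -> Y \in Lfun P 2%:E ->
  independent_rv P X Y -> mean (fun w => centered X w * centered Y w) = 0.
Proof.
move=> LX LY iXY; have LX' := Lfun2_centered LX; have LY' := Lfun2_centered LY.
rewrite /mean independent_mean_prod.
- by rewrite -[X in X * _]/(mean _) mean_centered ?mul0r//; exact: Lfun2_integrable.
- apply: (@independent_rv_comp _ _ _ _ _ _ _ _ _ _ _ _ X Y (fun x => x - mean X)
    (fun y => y - mean Y)) => //.
  + by apply: measurable_funB => //; exact: measurable_cst.
  + by apply: measurable_funB => //; exact: measurable_cst.
- exact: Lfun2_integrable.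
- exact: Lfun2_integrable.
- exact: Lfun2_integrableM.
Qed.

Lemma count_window (j H u v : nat) :
  (count (fun i => (i < j + H) && (j < i + H)) (index_iota u v) <= 2 * H)%N.
Proof.
rewrite -size_filter -(size_iota (j.+1 - H) (2 * H)).
apply: uniq_leq_size; first by rewrite filter_uniq// iota_uniq.
by move=> i; rewrite mem_filter mem_iota => /andP[/andP[? ?] _]; lia.
Qed.

(** Expand the square: for each j at most 2 H indices i lie at distance less than H, the other
    products have mean zero, and the remaining ones have mean at most V because 2 x y <= x^2 +
    y^2. *)
Lemma mean_sqr_sum_window (D : nat -> Omega -> R) (H : nat) (V : R) (u v : nat) :
  (forall j, D j \in Lfun P 2%:E) ->
  (forall j i, (j + H <= i)%N -> mean (fun w => D j w * D i w) = 0) ->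
  (forall j, mean (fun w => D j w ^+ 2) <= V) ->
  mean (fun w => (\sum_(u <= j < v) D j w) ^+ 2) <= (v - u)%:R * (2 * H)%:R * V.
Proof.
move=> LD D0 DV.
have V0 : 0 <= V by apply: le_trans (DV 0%N); apply: mean_ge0 => w; exact: sqr_ge0.
have iDD i j : P.-integrable setT (EFin \o (fun w => D i w * D j w)).
  exact: Lfun2_integrableM.
have DDV i j : mean (fun w => D i w * D j w) <= V.
  have : mean (fun w => 2 * (D i w * D j w)) <= mean (fun w => D i w ^+ 2 + D j w ^+ 2).
    apply: le_mean.
    - exact: integrableZEFin.
    - by apply: integrableDEFin; exact: Lfun2_integrableX.
    - move=> w; rewrite -subr_ge0.
      have -> : D i w ^+ 2 + D j w ^+ 2 - 2 * (D i w * D j w) = (D i w - D j w) ^+ 2 by ring.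
      exact: sqr_ge0.
  rewrite meanZ// meanD; try exact: Lfun2_integrableX.
  by have := DV i; have := DV j; lra.
have -> : (fun w => (\sum_(u <= j < v) D j w) ^+ 2) =
    fun w => \sum_(u <= j < v) \sum_(u <= i < v) D j w * D i w.
  apply/funext => w; rewrite expr2 mulr_suml; apply: eq_bigr => j _.
  by rewrite mulr_sumr.
rewrite mean_sum; last by move=> j; exact: integrable_sumEFin.
rewrite -mulrA mulr_natl -sumr_const_nat; apply: ler_sum => j _.
rewrite mean_sum//.
rewrite (bigID (fun i => (i < j + H) && (j < i + H))%N)/= [X in _ + X]big1 ?addr0; last first.
  move=> i; rewrite negb_and -!leqNgt => /orP[jH|iH]; first exact: D0.
  rewrite -[RHS](D0 _ _ iH); congr mean; apply/funext => w; exact: mulrC.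
apply: (@le_trans _ _ (\sum_(u <= i < v | (i < j + H)%N && (j < i + H)%N) V)).
  by apply: ler_sum => i _; exact: DDV.
rewrite big_const_seq iter_addr_0 -[leLHS]mulr_natl ler_wpM2r// ler_nat.
exact: count_window.
Qed.

(* Weighted AM-GM, (S + x)^2 <= (1 + a / A) S^2 + (1 + A / a) x^2, replaces
   Minkowski's inequality. *)
Lemma mean_sqr_sum_le (K : R) (L : nat) (x : nat -> Omega -> R) (a : nat -> R) :
  (forall s, x s \in Lfun P 2%:E) -> (forall s, 0 < a s) ->
  (forall s, mean (fun w => x s w ^+ 2) <= K * a s ^+ 2) ->
  mean (fun w => (\sum_(0 <= s < L) x s w) ^+ 2) <= K * (\sum_(0 <= s < L) a s) ^+ 2.
Proof.
move=> Lx a0 xa; elim: L => [|L IH].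
  rewrite (_ : (fun _ => _) = fun=> 0) ?mean_cst.
    by rewrite big_geq// expr0n mulr0.
  by apply/funext => w; rewrite big_geq// expr0n.
(* A single term is treated apart: the weighted inequality divides by the partial sum A, which is
   zero for the empty sum. *)
case: L IH => [_|L IH].
  rewrite big_nat1; have := xa 0%N; congr (mean _ <= _).
  by apply/funext => w; rewrite big_nat1.
set A := \sum_(0 <= s < L.+1) a s in IH *.
have A0 : 0 < A.
  by rewrite /A big_nat_recr//= ltr_wpDl ?sumr_ge0// => i _; exact/ltW.
rewrite [in leRHS]big_nat_recr//= -/A.
set S := fun w => \sum_(0 <= s < L.+1) x s w.
have LS : S \in Lfun P 2%:E by exact: Lfun2_sum.
rewrite -/S in IH.
set b := a L.+1; set y := x L.+1.
have b0 : 0 < b by exact: a0.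
have Ly : y \in Lfun P 2%:E by exact: Lx.
apply: (@le_trans _ _ (mean (fun w => (1 + b / A) * S w ^+ 2 + (1 + A / b) * y w ^+ 2))).
  apply: le_mean.
  - apply: Lfun2_integrableX; exact: Lfun2_sum.
  - by apply: integrableDEFin; apply: integrableZEFin; exact: Lfun2_integrableX.
  - move=> w; rewrite big_nat_recr//= -/(S w) -/(y w) -subr_ge0.
    have -> : (1 + b / A) * S w ^+ 2 + (1 + A / b) * y w ^+ 2 - (S w + y w) ^+ 2 =
       (A * b)^-1 * (b * S w - A * y w) ^+ 2 by field; rewrite !gt_eqF.
    by rewrite mulr_ge0 ?sqr_ge0// invr_ge0 mulr_ge0 ?ltW.
rewrite meanD; [|by apply: integrableZEFin; exact: Lfun2_integrableX..].
rewrite !meanZ; [|exact: Lfun2_integrableX..].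
have -> : K * (A + b) ^+ 2 = (1 + b / A) * (K * A ^+ 2) + (1 + A / b) * (K * b ^+ 2).
  by field; rewrite !gt_eqF.
have := xa L.+1; rewrite -/b -/y => xL.
by rewrite lerD// ler_wpM2l// addr_ge0// divr_ge0// ltW.
Qed.

End SecondMoments.

(** * Variance of block sums along the chain *)

Section ChainMoments.
Context d (Omega : measurableType d) (R : realType) (P : probability Omega R).
Context dF dF' (F : measurableType dF) (F' : measurableType dF').
Variables (g : F * F' -> F) (U : int -> {RV P >-> F'}) (X0 : F) (f : F -> R).
Variable nu : nat -> R.
Hypothesis mg : measurable_fun setT g.
Hypothesis iidU : iid P (fun i : int => U i : Omega -> F').
Hypothesis mf : measurable_fun setT f.
Hypothesis L2f : forall i : nat, f \o chain g X0 U i \in Lfun P 2%:E.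
Hypothesis nu_gt0 : forall i, 0 < nu i.
Hypothesis nu_bound : forall i m : nat,
  ('E_P[fun w => ((f (chain_from g X0 U i m w) - f (chain g X0 U i w)) ^+ 2)%R]
     <= (nu i)%:E)%E.

Definition obs (a : int) (n : nat) : Omega -> R := f \o run g U X0 a n.

Lemma Lfun2_obs a n : obs a n \in Lfun P 2%:E.
Proof.
have := L2f n; rewrite chainE => /Lfun2P[_ I0]; apply/Lfun2P; split.
  by apply: measurableT_comp => //; exact: measurable_run.
apply: le_lt_trans I0; rewrite le_eqVlt; apply/orP; left; apply/eqP.
apply: (@same_law_ge0_integral _ _ _ _ _ _ (run g U X0 a n) (run g U X0 0 n)
  (fun x => (f x ^+ 2)%:E)).
- exact: measurable_run.
- exact: measurable_run.
- exact: same_law_run.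
- by apply/measurable_EFinP; exact: measurable_funX.
- by move=> x; rewrite lee_fin sqr_ge0.
Qed.

(** [nu_bound] is the case a = - m; shift invariance of the joint law carries it to every start. *)
Lemma mean_obsB_sqr a m i :
  mean P (fun w => (obs a (m + i)%N w - obs (a + m%:Z) i w) ^+ 2) <= nu i.
Proof.
rewrite -lee_fin; apply: le_trans (nu_bound i m).
rewrite /mean /Rintegral fineK; last first.
  apply: integrable_fin_num => //; apply: Lfun2_integrable_sqr.
  by apply: Lfun2B; exact: Lfun2_obs.
rewrite unlock chainE chain_fromE.
have -> : absz (i%:Z + m%:Z) = (m + i)%N by lia.
rewrite le_eqVlt; apply/orP; left; apply/eqP.
pose phi := fun z : (F * F)%type => ((f z.1 - f z.2) ^+ 2)%:E.
have -> : run g U X0 0 i = run g U X0 (- m%:Z + m%:Z) i by congr run; lia.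
apply: (@same_law_ge0_integral _ _ _ _ _ _
  (fun w => (run g U X0 a (m + i) w, run g U X0 (a + m%:Z) i w))
  (fun w => (run g U X0 (- m%:Z) (m + i) w, run g U X0 (- m%:Z + m%:Z) i w)) phi).
- by apply: measurable_fun_pair; exact: measurable_run.
- by apply: measurable_fun_pair; exact: measurable_run.
- exact: same_law_run2.
- apply/measurable_EFinP; apply: measurable_funX; apply: measurable_funB.
    by apply: measurableT_comp => //; exact: measurable_fst.
  by apply: measurableT_comp => //; exact: measurable_snd.
- by move=> x; rewrite lee_fin sqr_ge0.
Qed.

Lemma measurable_obs_gens (S : set int) a n : itvz a n `<=` S ->
  measurable_fun (setT : set (g_sigma_algebraType (gens U S))) (obs a n).
Proof. by move=> aS; apply: measurableT_comp => //; exact: measurable_run_gens. Qed.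

(* [lag s] runs through 0, 1, 2, 4, 8, ... *)
Definition lag (s : nat) : nat := (2 ^ s)./2.

(* Increment between the chains that start at [X0] at most [lag s.+1] and at
   most [lag s] steps before time [j]: increments of level [s] at times at least
   [2 ^ s] apart are independent. *)
Definition lag_obs (j h : nat) : Omega -> R :=
  obs (j%:Z - (minn h j)%:Z) (minn h j).
Definition incr (s j : nat) : Omega -> R :=
  fun w => lag_obs j (lag s.+1) w - lag_obs j (lag s) w.

Lemma lagS s : lag s.+1 = (2 ^ s)%N.
Proof. by rewrite /lag expnS mul2n doubleK. Qed.

Lemma leq_lagS s : (lag s <= lag s.+1)%N.
Proof. by rewrite lagS /lag -divn2 leq_div. Qed.

Lemma Lfun2_incr s j : incr s j \in Lfun P 2%:E.
Proof. by apply: Lfun2B; exact: Lfun2_obs. Qed.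

Lemma mean_incr_sqr s j : mean P (fun w => incr s j w ^+ 2) <= nu (lag s).
Proof.
have h := leq_lagS s; have [hj|jh] := leqP (lag s) j.
  have := mean_obsB_sqr (j%:Z - (minn (lag s.+1) j)%:Z)
    (minn (lag s.+1) j - lag s)%N (lag s).
  rewrite /incr /lag_obs (minn_idPl hj).
  have -> : (minn (lag s.+1) j - lag s + lag s = minn (lag s.+1) j)%N by lia.
  have -> // : j%:Z - (minn (lag s.+1) j)%:Z + (minn (lag s.+1) j - lag s)%N%:Z
    = j%:Z - (lag s)%:Z by lia.
(* For j < [lag s] both lags are cut down to j and the increment vanishes. *)
rewrite (_ : (fun _ => _) = fun=> 0); first by rewrite mean_cst ltW.
apply/funext => w; rewrite /incr /lag_obs.
have -> : minn (lag s.+1) j = minn (lag s) j by lia.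
by rewrite subrr expr0n.
Qed.

Lemma mean_incrM s j i : (j + 2 ^ s <= i)%N ->
  mean P (fun w => centered P (incr s j) w * centered P (incr s i) w) = 0.
Proof.
move=> ji; apply: independent_mean_centeredM; try exact: Lfun2_incr.
(* Level s looks back at most [lag s.+1] = 2^s steps, so its value at time k uses only the
   innovations in this window. *)
pose S k : set int := itvz (k%:Z - (2 ^ s)%N%:Z) (2 ^ s).
apply: (@independent_gens _ _ _ _ _ _ _ U (S j) (S i)).
- by case: iidU.
- by apply/seteqP; split => // k [[h1 h2] [h3 h4]]; lia.
- have h := leq_lagS s; have hS := lagS s.
  by apply: measurable_funB; apply: measurable_obs_gens => k [h1 h2]; split; lia.
- have h := leq_lagS s; have hS := lagS s.
  by apply: measurable_funB; apply: measurable_obs_gens => k [h1 h2]; split; lia.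
Qed.

(** The increments telescope from lag 0, where the observation is the constant f X0, to a lag that
    reaches back to time 0. Centering removes the constant. *)
Lemma centered_obsE L j : (j <= lag L)%N ->
  centered P (obs 0 j) = fun w => \sum_(0 <= s < L) centered P (incr s j) w.
Proof.
move=> jL; rewrite -centered_sum; last by move=> s; exact: Lfun2_incr.
rewrite -(centeredD_cst (- f X0)); last exact: Lfun2_obs.
congr centered; apply/funext => w.
rewrite telescope_sumr//; congr (_ - _); rewrite /lag_obs.
  by rewrite (minn_idPr jL) subrr.
by rewrite (_ : minn (lag 0) j = 0%N) // /lag min0n.
Qed.

Definition weight (s : nat) : R := Num.sqrt (2 ^+ s * nu (lag s)).

(** The windowed bound with H = 2^s gives level s a mean square of at most 2 (v - u) weight(s)^2;
    the levels are not independent of each other, so they are added as in the triangle inequality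
    for the L^2 norm. *)
Lemma mean_centered_block u v L : (v <= lag L)%N ->
  mean P (fun w => (\sum_(u <= j < v) centered P (obs 0 j) w) ^+ 2) <=
  2 * (v - u)%:R * (\sum_(0 <= s < L) weight s) ^+ 2.
Proof.
move=> vL.
rewrite (_ : (fun _ => _) = (fun w =>
    (\sum_(0 <= s < L) (\sum_(u <= j < v) centered P (incr s j) w)) ^+ 2)); last first.
  apply/funext => w; congr (_ ^+ 2); rewrite exchange_big/=.
  apply: eq_big_nat => j /andP[_ jv].
  by rewrite (@centered_obsE L)// (leq_trans _ vL)// ltnW.
apply: mean_sqr_sum_le => s.
- by apply: Lfun2_sum => j; apply: Lfun2_centered; exact: Lfun2_incr.
- by rewrite sqrtr_gt0 mulr_gt0// exprn_gt0.
rewrite sqr_sqrtr; last by rewrite mulr_ge0 ?exprn_ge0// ltW.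
apply: le_trans (@mean_sqr_sum_window _ _ _ P (fun j => centered P (incr s j))
  (2 ^ s) (nu (lag s)) u v _ _ _) _.
- by move=> j; apply: Lfun2_centered; exact: Lfun2_incr.
- by move=> j i; exact: mean_incrM.
- move=> j; apply: le_trans (mean_incr_sqr s j).
  by apply: mean_centered_sqr_le; exact: Lfun2_incr.
rewrite le_eqVlt; apply/orP; left; apply/eqP.
by rewrite natrM natrX; ring.
Qed.

End ChainMoments.

(** * The estimators *)

Section Mixture.
Context d (Omega : measurableType d) (R : realType) (P : probability Omega R).

Lemma mean_indic (A : set Omega) : measurable A -> mean P (\1_A) = fine (P A).
Proof.
move=> mA; rewrite /mean /Rintegral; congr fine.
by rewrite integral_indic// setIT.
Qed.

(** A preimage under the indicator is the empty set, [A], its complement or the whole space, so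
    independence of the single event [A] from X extends to the indicator as a random variable. *)
Lemma mean_indicM (A : set Omega) d1 (T1 : measurableType d1) (X : Omega -> T1)
    (h : T1 -> R) :
  measurable A -> measurable_fun setT X -> measurable_fun setT h ->
  (forall B, measurable B -> P (A `&` X @^-1` B) = (P A * P (X @^-1` B))%E) ->
  P.-integrable setT (EFin \o (h \o X)) ->
  P.-integrable setT (EFin \o (fun w => \1_A w * h (X w))) /\
  mean P (fun w => \1_A w * h (X w)) = fine (P A) * mean P (fun w => h (X w)).
Proof.
move=> mA mX mh indA ihX.
have iA : P.-integrable setT (EFin \o (\1_A : Omega -> R)).
  by apply: integrable_indic => //; exact: fin_num_fun_lty; exact: fin_num_measure.
have iAh : P.-integrable setT (EFin \o (fun w => \1_A w * h (X w))).
  apply: le_integrable ihX => //.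
    apply/measurable_EFinP; apply: measurable_funM; first exact: measurable_indic.
    exact: measurableT_comp.
  move=> w _ /=; rewrite lee_fin normrM ler_piMl// indicE.
  by case: (w \in A); rewrite ?normr1 ?normr0.
split=> //.
rewrite -mean_indic// /mean independent_mean_prod// => B C mB mC.
have mXC : measurable (X @^-1` (h @^-1` C)).
  rewrite -[_ @^-1` _]setTI; apply: mX => //.
  by rewrite -[_ @^-1` _]setTI; exact: mh.
have PXC D : D \in [:: set0; A; ~` A; setT] ->
    P (D `&` X @^-1` (h @^-1` C)) = (P D * P (X @^-1` (h @^-1` C)))%E.
  have indA' : P (A `&` X @^-1` (h @^-1` C)) = (P A * P (X @^-1` (h @^-1` C)))%E.
    by apply: indA; rewrite -[_ @^-1` _]setTI; exact: mh.
  rewrite !inE => /or4P[] /eqP ->.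
  - by rewrite set0I measure0 mul0e.
  - exact: indA'.
  - have mC' : measurable (X @^-1` (h @^-1` C)) := mXC.
    rewrite setIC -setDE measureD//; last first.
      by rewrite -ge0_fin_numE// fin_num_measure.
    rewrite [Y in (_ - Y)%E](_ : _ = (P A * P (X @^-1` (h @^-1` C)))%E); last first.
      by rewrite setIC; exact: indA'.
    rewrite probability_setC//.
    rewrite -[LHS]/(P (X @^-1` (h @^-1` C)) - P A * P (X @^-1` (h @^-1` C)))%E.
    rewrite -(fineK (fin_num_measure P _ mA)) -(fineK (fin_num_measure P _ mC')).
    by rewrite -EFinD -!EFinM; congr EFin; ring.
  - by rewrite (setTI (X @^-1` (h @^-1` C))) (@probability_setT _ _ _ P) mul1e.
rewrite -[X in P (_ `&` X)]/(X @^-1` (h @^-1` C)).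
rewrite -[X in (_ * P X)%E]/(X @^-1` (h @^-1` C)).
apply: PXC.
rewrite preimage_indic; do 2 case: ifPn => _; by rewrite !inE eqxx ?orbT.
Qed.

(** Partition by the value of N. Only independence of the event N = l from W_l enters, one level at
    a time. *)
Lemma ge0_integral_mixture (N : {RV P >-> nat}) (p : nat -> R) (W : nat -> Omega -> R) :
  (forall l, P (N @^-1` [set l]) = (p l)%:E) ->
  (forall l, W l \in Lfun P 2%:E) ->
  (forall l B, measurable B ->
     P (N @^-1` [set l] `&` W l @^-1` B) = (P (N @^-1` [set l]) * P (W l @^-1` B))%E) ->
  measurable_fun setT (fun w => W (N w) w) /\
  (\int[P]_w (W (N w) w ^+ 2)%:E
    = \sum_(0 <= l <oo) (p l * mean P (fun w => W l w ^+ 2))%:E)%E.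
Proof.
move=> pN LW indNW.
have mW l : measurable_fun setT (W l) by have /Lfun2P[] := LW l.
have mN l : measurable (N @^-1` [set l]).
  by rewrite -[_ @^-1` _]setTI; exact: measurable_funP.
have NT : \bigcup_l (N @^-1` [set l]) = setT.
  by apply/seteqP; split=> // w _; exists (N w).
have mWN : measurable_fun setT (fun w => W (N w) w).
  move=> _ B mB; rewrite setTI.
  rewrite (_ : _ @^-1` _ = \bigcup_l (N @^-1` [set l] `&` W l @^-1` B)).
    apply: bigcupT_measurable => l; apply: measurableI => //.
    by rewrite -[_ @^-1` _]setTI; exact: mW.
  apply/seteqP; split=> w /=; first by move=> BW; exists (N w).
  by move=> [l _ [/= -> ?]].
split=> //; rewrite -NT ge0_integral_bigcup//; first last.
- apply/trivIsetP => i j _ _ ij; apply/seteqP; split=> // w [/= Ni Nj].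
  by move: ij; rewrite -Ni -Nj eqxx.
- by move=> w _; rewrite lee_fin sqr_ge0.
- by rewrite NT; apply/measurable_EFinP; exact: measurable_funX.
apply: eq_eseriesr => l _.
have [iI mI] := @mean_indicM _ _ _ (W l) (fun x => x ^+ 2) (mN l) (mW l)
  (measurable_funX 2 (@measurable_id _ _ setT)) (indNW l)
  (Lfun2_integrableX (LW l)).
have := pN l => /(congr1 fine) /= <-; rewrite -mI /mean /Rintegral fineK; last first.
  exact: integrable_fin_num.
rewrite [LHS]integral_mkcond; apply: eq_integral => w _.
rewrite patchE /= indicE; case: ifPn => /=; last by rewrite mul0r.
by rewrite inE /= => ->; rewrite mul1r.
Qed.

(** Put V = Q Z / q. Then E V = E Z and E (X V) = E X E Z, so X and V are uncorrelated, while Var V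
    <= E V^2 = E Z^2 / q. *)
Lemma mean_randomized_sqr (X Z : Omega -> R) (Q : {RV P >-> bool}) (q : R) :
  0 < q -> X \in Lfun P 2%:E -> Z \in Lfun P 2%:E ->
  independent_rv P Z X -> P (Q @^-1` [set true]) = q%:E ->
  independent_rv P Q (fun w => (X w, Z w)) ->
  let Y := fun w => X w + q^-1 * (Q w)%:R * Z w in
  Y \in Lfun P 2%:E /\
  mean P (fun w => centered P Y w ^+ 2) <=
    mean P (fun w => centered P X w ^+ 2) + q^-1 * mean P (fun w => Z w ^+ 2).
Proof.
move=> q0 LX LZ iZX Qq iQ Y.
pose A := Q @^-1` [set true].
have mA : measurable A by rewrite -[A]setTI; exact: measurable_funP.
have QA w : (Q w)%:R = \1_A w :> R.
  rewrite indicE; congr (nat_of_bool _)%:R.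
  apply/idP/idP; first by move=> Qw; rewrite inE.
  by rewrite inE.
have /Lfun2P[mX _] := LX; have /Lfun2P[mZ _] := LZ.
have mXZ : measurable_fun setT (fun w => (X w, Z w)) by exact: measurable_fun_pair.
have key h : measurable_fun setT h -> P.-integrable setT (EFin \o (fun w => h (X w, Z w))) ->
    P.-integrable setT (EFin \o (fun w => \1_A w * h (X w, Z w))) /\
    mean P (fun w => \1_A w * h (X w, Z w)) = q * mean P (fun w => h (X w, Z w)).
  move=> mh ih; have [i1 i2] := @mean_indicM A _ _ (fun w => (X w, Z w)) h mA mXZ mh
    (fun B mB => iQ [set true] B I mB) ih.
  by split=> //; rewrite i2 Qq.
have [iAZ mAZ] := key snd measurable_snd (Lfun2_integrable LZ).
have [iAZ2 mAZ2] := key (fun z => z.2 ^+ 2)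
  (measurable_funX 2 measurable_snd) (Lfun2_integrableX LZ).
have [iAXZ mAXZ] := key (fun z => z.1 * z.2)
  (measurable_funM measurable_fst measurable_snd) (Lfun2_integrableM LX LZ).
have mXZE : mean P (fun w => X w * Z w) = mean P X * mean P Z.
  rewrite mulrC -independent_mean_prod//; last exact: Lfun2_integrableM.
  - by congr mean; apply/funext => w; rewrite mulrC.
  - exact: Lfun2_integrable.
  - exact: Lfun2_integrable.
pose V := fun w => q^-1 * (\1_A w * Z w).
have LV : V \in Lfun P 2%:E.
  apply: Lfun2Z; apply/Lfun2P; split.
    by apply: measurable_funM => //; exact: measurable_indic.
  have /integrableP[_] := iAZ2; apply: le_lt_trans.
  rewrite le_eqVlt; apply/orP; left; apply/eqP; apply: eq_integral => w _ /=.
  rewrite indicE; case: (w \in A); rewrite ?mul1r ?mul0r ?expr0n/= ?normr0//.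
  by rewrite ger0_norm// sqr_ge0.
have YE : Y = fun w => X w + V w.
  by apply/funext => w; rewrite /Y /V QA mulrA.
have LY : Y \in Lfun P 2%:E by rewrite YE; exact: Lfun2D.
split=> //.
have mV : mean P V = mean P Z.
  by rewrite /V meanZ// [X in _ * X]mAZ mulrA mulVf ?mul1r// gt_eqF.
have mXV : mean P (fun w => X w * V w) = mean P X * mean P Z.
  transitivity (mean P (fun w => q^-1 * (\1_A w * (X w * Z w)))).
    by congr mean; apply/funext => w; rewrite /V; ring.
  by rewrite meanZ// mAXZ mXZE mulrA mulVf ?mul1r// gt_eqF.
have mV2 : mean P (fun w => V w ^+ 2) = q^-1 * mean P (fun w => Z w ^+ 2).
  transitivity (mean P (fun w => q^-1 ^+ 2 * (\1_A w * Z w ^+ 2))).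
    congr mean; apply/funext => w; rewrite /V indicE.
    by case: (w \in A); rewrite ?mul1r ?mul0r ?mulr0 ?expr0n// exprMn.
  by rewrite meanZ// mAZ2; field; rewrite gt_eqF.
rewrite !mean_centered_sqr//.
have -> : mean P Y = mean P X + mean P Z.
  by rewrite YE meanD ?mV//; exact: Lfun2_integrable.
have -> : mean P (fun w => Y w ^+ 2) =
    mean P (fun w => X w ^+ 2) + (2 * (mean P X * mean P Z) + q^-1 * mean P (fun w => Z w ^+ 2)).
  transitivity (mean P (fun w => X w ^+ 2 + (2 * (X w * V w) + V w ^+ 2))).
    by congr mean; apply/funext => w; rewrite YE; ring.
  have iXV : P.-integrable setT (EFin \o (fun w => 2 * (X w * V w))).
    by apply: integrableZEFin; exact: Lfun2_integrableM.
  have iX2 := Lfun2_integrableX LX; have iV2 := Lfun2_integrableX LV.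
  rewrite meanD//; last exact: integrableDEFin.
  by rewrite meanD// meanZ ?mXV ?mV2//; exact: Lfun2_integrableM.
have := sqr_ge0 (mean P Z); nra.
Qed.

End Mixture.

(** * Second moments of the averages, of Z_k and of the randomized estimator *)

Section EstimatorMoments.
Context d (Omega : measurableType d) (R : realType) (P : probability Omega R).
Context dF dF' (F : measurableType dF) (F' : measurableType dF').
Variables (g : F * F' -> F) (U : int -> {RV P >-> F'}) (X0 : F) (f : F -> R).
Variable nu : nat -> R.
Hypothesis mg : measurable_fun setT g.
Hypothesis iidU : iid P (fun i : int => U i : Omega -> F').
Hypothesis mf : measurable_fun setT f.
Hypothesis L2f : forall i : nat, f \o chain g X0 U i \in Lfun P 2%:E.
Hypothesis nu_gt0 : forall i, 0 < nu i.
Hypothesis nu_bound : forall i m : nat,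
  ('E_P[fun w => ((f (chain_from g X0 U i m w) - f (chain g X0 U i w)) ^+ 2)%R]
     <= (nu i)%:E)%E.
Variables (b b' : nat -> nat) (k : nat).
Hypothesis k_gt0 : (0 < k)%N.
Hypothesis leb : (b k <= b' k)%N.
Hypothesis leb' : (b' k)%:R <= k%:R / 2 :> R.

Local Notation obs := (obs g U X0 f).
Local Notation fk := (fk g X0 U f b k).
Local Notation fkl := (fkl g X0 U f b' k).
Local Notation start l := (k * (2 ^ l - 1))%N.

Let L2obs a n : obs a n \in Lfun P 2%:E.
Proof. exact: Lfun2_obs. Qed.

Lemma double_burnin_le : (2 * b' k <= k)%N.
Proof. by rewrite -(ler_nat R) natrM; have := leb'; lra. Qed.

Lemma fkE : fk = fun w => (k%:R - (b k)%:R)^-1 * \sum_(b k <= i < k) obs 0 i w.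
Proof.
apply/funext => w; rewrite /Defs.fk; congr (_ * _); apply: eq_bigr => i _.
by rewrite chainE.
Qed.

Lemma fklE l : fkl l = fun w => (k%:R - (b' k)%:R)^-1 *
  \sum_(b' k <= i < k) obs (- (start l)%:Z) (start l + i)%N w.
Proof.
apply/funext => w; rewrite /Defs.fkl; congr (_ * _); apply: eq_bigr => i _.
by rewrite chain_fromE /obs /=; congr (f (run _ _ _ _ _ _)); lia.
Qed.

Lemma Lfun2_fk : fk \in Lfun P 2%:E.
Proof. by rewrite fkE; apply: Lfun2Z; exact: Lfun2_sum. Qed.

Lemma Lfun2_fkl l : fkl l \in Lfun P 2%:E.
Proof. by rewrite fklE; apply: Lfun2Z; exact: Lfun2_sum. Qed.

Lemma centered_fk : centered P fk = fun w =>
  (k%:R - (b k)%:R)^-1 * \sum_(b k <= i < k) centered P (obs 0 i) w.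
Proof. by rewrite fkE centeredZ ?centered_sum//; exact: Lfun2_sum. Qed.

Lemma centered_fkl0 : centered P (fkl 0) = fun w =>
  (k%:R - (b' k)%:R)^-1 * \sum_(b' k <= i < k) centered P (obs 0 i) w.
Proof.
rewrite fklE centeredZ ?centered_sum//; last exact: Lfun2_sum.
by rewrite expn0 subnn muln0 oppr0.
Qed.

Lemma leq_lag n : (n <= lag n.+1)%N.
Proof. by rewrite lagS ltnW// ltn_expl. Qed.

Lemma mean_centered_fkl0_le (M : R) :
  (forall L, \sum_(0 <= s < L) weight nu s <= M) ->
  mean P (fun w => centered P (fkl 0) w ^+ 2) <=
  mean P (fun w => centered P fk w ^+ 2) +
  16 * M ^+ 2 / k%:R * Num.sqrt (((b' k)%:R - (b k)%:R) / k%:R).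
Proof.
move=> HM; have M0 : 0 <= M by have := HM 0%N; rewrite big_geq.
have k0 : 0 < k%:R :> R by rewrite ltr0n.
have bl := leb'; have bb : (b k)%:R <= (b' k)%:R :> R by rewrite ler_nat.
have b0 : 0 <= (b k)%:R :> R by [].
have b'k : (b' k <= k)%N by have := double_burnin_le; lia.
have block u v : (v <= k)%N ->
    mean P (fun w => (\sum_(u <= j < v) centered P (obs 0 j) w) ^+ 2)
      <= 2 * (v - u)%:R * M ^+ 2.
  move=> vk; apply: le_trans.
    apply: (mean_centered_block mg iidU mf L2f nu_gt0 nu_bound u (L := k.+1)).
    by apply: leq_trans vk (leq_lag k).
  rewrite ler_wpM2l ?mulr_ge0// ler_sqr ?nnegrE//.
  by apply: sumr_ge0 => s _; exact: sqrtr_ge0.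
(* Equal burn-ins are treated apart, since the argument divides by sqrt ((b' - b) / k). *)
have [eb|nb] := eqVneq (b k) (b' k).
  rewrite -eb subrr mul0r sqrtr0 mulr0 addr0.
  by rewrite centered_fkl0 centered_fk eb.
set S1 := fun w => \sum_(b k <= j < b' k) centered P (obs 0 j) w.
set S2 := fun w => \sum_(b' k <= j < k) centered P (obs 0 j) w.
set beta := (b' k)%:R - (b k)%:R : R.
set n' := k%:R - (b' k)%:R : R.
have beta0 : 0 < beta by rewrite subr_gt0 ltr_nat ltn_neqAle nb.
have n'k : k%:R / 2 <= n' by rewrite /n'; lra.
have n'0 : 0 < n' by lra.
have nE : k%:R - (b k)%:R = n' + beta :> R by rewrite /n' /beta; ring.
have LS1 : S1 \in Lfun P 2%:E by apply: Lfun2_sum => j; exact: Lfun2_centered.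
have LS2 : S2 \in Lfun P 2%:E by apply: Lfun2_sum => j; exact: Lfun2_centered.
have E1 : mean P (fun w => S1 w ^+ 2) <= 2 * beta * M ^+ 2.
  by have := block (b k) (b' k) b'k; rewrite natrB.
have E2 : mean P (fun w => S2 w ^+ 2) <= 2 * n' * M ^+ 2.
  by have := block (b' k) k (leqnn k); rewrite natrB.
rewrite centered_fkl0 centered_fk nE -/n' -/S2.
have SE w : \sum_(b k <= j < k) centered P (obs 0 j) w = S1 w + S2 w.
  by rewrite /S1 /S2 -big_cat_nat.
(* This weight balances the two error terms: the bounds on E (v - u)^2 / r and on r E (v + u)^2 both
   become 8 M^2 r / k. *)
set r := Num.sqrt (beta / k%:R).
have r0 : 0 < r by rewrite sqrtr_gt0 divr_gt0.
have r2 : r ^+ 2 = beta / k%:R by rewrite sqr_sqrtr// ltW// divr_gt0.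
have betaE : beta = r ^+ 2 * k%:R by rewrite r2 divfK// gt_eqF.
set n := n' + beta.
have n0 : 0 < n by rewrite addr_gt0.
(* For v, u the two centered averages, v^2 <= u^2 + (x/2) (v - u)^2 + (v + u)^2 / (2 x)
   with x = 1 / r, and both squares are quadratic forms in the block sums. *)
pose ub w : R := (n^-1 * (S1 w + S2 w)) ^+ 2
  + r^-1 * (n ^- 2 * (beta ^+ 2 * n' ^- 2 * S2 w ^+ 2 + S1 w ^+ 2))
  + r * (n' ^- 2 * S2 w ^+ 2 + (n^-1 * (S1 w + S2 w)) ^+ 2).
have ubP w : (n'^-1 * S2 w) ^+ 2 <= ub w.
  set u := n^-1 * (S1 w + S2 w); set v := n'^-1 * S2 w.
  have -> : ub w = u ^+ 2 + r^-1 * ((n^-1 * (beta * v)) ^+ 2 + (n^-1 * S1 w) ^+ 2)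
     + r * (v ^+ 2 + u ^+ 2).
    rewrite /ub -/u; congr (_ + _ * _ + _ * (_ + _)); rewrite /v.
      by field; rewrite !gt_eqF.
    by field; rewrite !gt_eqF.
  have vu : v - u = n^-1 * (beta * v) - n^-1 * S1 w.
    by rewrite /v /u /n; field; rewrite !gt_eqF.
  set p := n^-1 * (beta * v) in vu *; set s := n^-1 * S1 w in vu *.
  have H1 : 0 <= r^-1 * (p + s) ^+ 2 by rewrite mulr_ge0 ?sqr_ge0 ?invr_ge0 ?ltW.
  have H2 : 0 <= r * (v - u) ^+ 2 by rewrite mulr_ge0 ?sqr_ge0 ?ltW.
  have H3 : 0 <= r * (r^-1 * (v - u) - (v + u)) ^+ 2 by rewrite mulr_ge0 ?sqr_ge0 ?ltW.
  have H3' : r * (r^-1 * (v - u) - (v + u)) ^+ 2 =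
     r^-1 * (v - u) ^+ 2 - 2 * (v ^+ 2 - u ^+ 2) + r * (v + u) ^+ 2.
    by field; rewrite gt_eqF.
  have H4 : r^-1 * (v - u) ^+ 2 = r^-1 * (2 * (p ^+ 2 + s ^+ 2)) - r^-1 * (p + s) ^+ 2.
    by rewrite vu; ring.
  have H5 : r * (v + u) ^+ 2 = r * (2 * (v ^+ 2 + u ^+ 2)) - r * (v - u) ^+ 2 by ring.
  lra.
have iS2 := Lfun2_integrableX LS2; have iS1 := Lfun2_integrableX LS1.
have Lu : (fun w => n^-1 * (S1 w + S2 w)) \in Lfun P 2%:E.
  by apply: Lfun2Z; exact: Lfun2D.
have iu := Lfun2_integrableX Lu.
have Eu : mean P (fun w => (n^-1 * (S1 w + S2 w)) ^+ 2) <= n ^- 2 * (2 * n * M ^+ 2).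
  have -> : (fun w => (n^-1 * (S1 w + S2 w)) ^+ 2) =
      (fun w => n ^- 2 * (\sum_(b k <= j < k) centered P (obs 0 j) w) ^+ 2).
    by apply/funext => w; rewrite SE exprMn exprVn.
  rewrite meanZ; last first.
    by apply: Lfun2_integrableX; apply: Lfun2_sum => j; exact: Lfun2_centered.
  rewrite ler_wpM2l ?invr_ge0 ?sqr_ge0//.
  have := block (b k) k (leqnn k); rewrite natrB; first by rewrite nE.
  exact: leq_trans leb b'k.
have i1 : P.-integrable setT (EFin \o (fun w => beta ^+ 2 * n' ^- 2 * S2 w ^+ 2)).
  exact: integrableZEFin.
have i2 : P.-integrable setT
    (EFin \o (fun w => beta ^+ 2 * n' ^- 2 * S2 w ^+ 2 + S1 w ^+ 2)).
  exact: integrableDEFin.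
have i3 : P.-integrable setT
    (EFin \o (fun w => n ^- 2 * (beta ^+ 2 * n' ^- 2 * S2 w ^+ 2 + S1 w ^+ 2))).
  exact: integrableZEFin.
have i4 : P.-integrable setT
    (EFin \o (fun w => r^-1 * (n ^- 2 * (beta ^+ 2 * n' ^- 2 * S2 w ^+ 2 + S1 w ^+ 2)))).
  exact: integrableZEFin.
have i5 : P.-integrable setT (EFin \o (fun w => n' ^- 2 * S2 w ^+ 2)).
  exact: integrableZEFin.
have i6 : P.-integrable setT
    (EFin \o (fun w => n' ^- 2 * S2 w ^+ 2 + (n^-1 * (S1 w + S2 w)) ^+ 2)).
  exact: integrableDEFin.
have i7 : P.-integrable setT
    (EFin \o (fun w => r * (n' ^- 2 * S2 w ^+ 2 + (n^-1 * (S1 w + S2 w)) ^+ 2))).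
  exact: integrableZEFin.
have i8 := integrableDEFin iu i4.
have iub : P.-integrable setT (EFin \o ub) by exact: (integrableDEFin i8 i7).
have -> : (fun w => (n^-1 * \sum_(b k <= i < k) centered P (obs 0 i) w) ^+ 2) =
    (fun w => (n^-1 * (S1 w + S2 w)) ^+ 2).
  by apply/funext => w; rewrite SE.
apply: (@le_trans _ _ (mean P ub)).
  apply: le_mean => //; apply: Lfun2_integrableX; exact: Lfun2Z.
rewrite /ub meanD// meanD// !meanZ// meanD// meanD// !meanZ//.
rewrite -addrA lerD2l.
have B1 : n ^- 2 * (beta ^+ 2 * n' ^- 2 * mean P (fun w => S2 w ^+ 2)
    + mean P (fun w => S1 w ^+ 2)) <= 8 * beta * M ^+ 2 / k%:R ^+ 2.
  apply: (@le_trans _ _ (n ^- 2 * (beta ^+ 2 * n' ^- 2 * (2 * n' * M ^+ 2)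
      + 2 * beta * M ^+ 2))).
    rewrite ler_wpM2l ?invr_ge0 ?sqr_ge0// lerD// ler_wpM2l// mulr_ge0 ?sqr_ge0//.
    by rewrite invr_ge0 sqr_ge0.
  (* Since n = n' + beta, beta^2 / n' + beta = beta n / n'; then n and n' are both at least k /
     2. *)
  have -> : n ^- 2 * (beta ^+ 2 * n' ^- 2 * (2 * n' * M ^+ 2) + 2 * beta * M ^+ 2) =
     2 * beta * M ^+ 2 * (n * n')^-1.
    by rewrite /n; field; rewrite !gt_eqF.
  have -> : 8 * beta * M ^+ 2 / k%:R ^+ 2 = 2 * beta * M ^+ 2 * (k%:R ^+ 2 / 4)^-1.
    by field; rewrite gt_eqF.
  rewrite ler_wpM2l ?mulr_ge0 ?sqr_ge0 ?(ltW beta0)//.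
  by rewrite lef_pV2 ?posrE ?divr_gt0 ?exprn_gt0 ?mulr_gt0//; rewrite /n; nra.
have B2 : n' ^- 2 * mean P (fun w => S2 w ^+ 2) +
    mean P (fun w => (n^-1 * (S1 w + S2 w)) ^+ 2) <= 8 * M ^+ 2 / k%:R.
  have h x : k%:R / 2 <= x -> x ^- 2 * (2 * x * M ^+ 2) <= 4 * M ^+ 2 / k%:R.
    move=> kx; have x0 : 0 < x by lra.
    have -> : x ^- 2 * (2 * x * M ^+ 2) = 2 * M ^+ 2 * x^-1 by field; rewrite gt_eqF.
    have -> : 4 * M ^+ 2 / k%:R = 2 * M ^+ 2 * (k%:R / 2)^-1 by field; rewrite gt_eqF.
    by rewrite ler_wpM2l ?mulr_ge0 ?sqr_ge0// lef_pV2 ?posrE// divr_gt0.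
  have h2 : n' ^- 2 * mean P (fun w => S2 w ^+ 2) <= n' ^- 2 * (2 * n' * M ^+ 2).
    by rewrite ler_wpM2l ?invr_ge0 ?sqr_ge0.
  have := h _ n'k; have : k%:R / 2 <= n by rewrite /n; lra.
  by move=> /h; lra.
have -> : 16 * M ^+ 2 / k%:R * r =
    r^-1 * (8 * beta * M ^+ 2 / k%:R ^+ 2) + r * (8 * M ^+ 2 / k%:R).
  by rewrite betaE; field; rewrite !gt_eqF.
by rewrite lerD// ler_wpM2l ?invr_ge0 ?(ltW r0).
Qed.

Lemma sqr_sum_le (x : nat -> R) (u v : nat) :
  (\sum_(u <= i < v) x i) ^+ 2 <= (v - u)%:R * \sum_(u <= i < v) x i ^+ 2.
Proof.
rewrite expr2 mulr_suml; under eq_bigr do rewrite mulr_sumr.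
apply: (@le_trans _ _ (\sum_(u <= i < v) \sum_(u <= j < v) (x i ^+ 2 + x j ^+ 2) / 2)).
  apply: ler_sum => i _; apply: ler_sum => j _.
  by have := sqr_ge0 (x i - x j); lra.
under eq_bigr do rewrite -mulr_suml big_split/= sumr_const_nat.
rewrite -mulr_suml big_split/= sumrMnl sumr_const_nat mulr_natl.
by move: (_ *+ _) => y; lra.
Qed.

(** The starts of levels l + 1 and l are k 2^l apart, so at time i the difference falls under
    [mean_obsB_sqr] with m = k 2^l and k (2^l - 1) + i common steps. Jensen's inequality moves the
    square inside the average. *)
Lemma mean_levelB_sqr l :
  mean P (fun w => (fkl l.+1 w - fkl l w) ^+ 2) <=
  (k%:R - (b' k)%:R)^-1 * \sum_(b' k <= i < k) nu (start l + i)%N.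
Proof.
have b'k : (b' k < k)%N by have := double_burnin_le; lia.
set n := k%:R - (b' k)%:R : R.
have n0 : 0 < n by rewrite subr_gt0 ltr_nat.
pose D i w := obs (- (start l.+1)%:Z) (start l.+1 + i)%N w
  - obs (- (start l)%:Z) (start l + i)%N w.
have LD i : D i \in Lfun P 2%:E by exact: Lfun2B.
have -> : (fun w => (fkl l.+1 w - fkl l w) ^+ 2) =
    fun w => n ^- 2 * (\sum_(b' k <= i < k) D i w) ^+ 2.
  by apply/funext => w; rewrite !fklE -mulrBr exprMn exprVn sumrB.
have LS : (fun w => \sum_(b' k <= i < k) D i w) \in Lfun P 2%:E by exact: Lfun2_sum.
have iS : P.-integrable setT (EFin \o (fun w => \sum_(b' k <= i < k) D i w ^+ 2)).
  by apply: integrable_sumEFin => i; exact: Lfun2_integrableX.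
apply: (@le_trans _ _ (mean P (fun w => n^-1 * \sum_(b' k <= i < k) D i w ^+ 2))).
  apply: le_mean.
  - by apply: integrableZEFin; exact: Lfun2_integrableX.
  - exact: integrableZEFin.
  - move=> w; have := sqr_sum_le (D^~ w) (b' k) k.
    rewrite natrB ?(ltnW b'k)// -/n => H.
    have -> : n^-1 * (\sum_(b' k <= i < k) D i w ^+ 2) =
      n ^- 2 * (n * \sum_(b' k <= i < k) D i w ^+ 2) by field; rewrite gt_eqF.
    by rewrite ler_wpM2l ?invr_ge0 ?sqr_ge0.
rewrite meanZ// mean_sum; last by move=> i; exact: Lfun2_integrableX.
rewrite ler_wpM2l ?invr_ge0 ?(ltW n0)//; apply: ler_sum => i _.
have := mean_obsB_sqr mg iidU mf L2f nu_bound (- (start l.+1)%:Z) (k * 2 ^ l)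
  (start l + i).
have p1 : (0 < 2 ^ l)%N by rewrite expn_gt0.
have e1 : start l.+1 = (k * 2 ^ l + start l)%N.
  by rewrite -mulnDr expnS; congr muln; lia.
have -> : (k * 2 ^ l + (start l + i) = start l.+1 + i)%N by rewrite e1 addnA.
by have -> : - (start l.+1)%:Z + (k * 2 ^ l)%N%:Z = - (start l)%:Z by rewrite e1; lia.
Qed.

Variables (p : nat -> R) (N : {RV P >-> nat}).
Hypothesis p_gt0 : forall l, 0 < p l.
Hypothesis indN : independent_of_family P N (fun i : int => U i : Omega -> F').
Hypothesis pN : forall l, P (N @^-1` [set l]) = (p l)%:E.

(** On N = l, Z_k is the level difference divided by p_l; weighting its mean square by p_l leaves
    one factor 1 / p_l. The bound is on an extended integral because it is what shows that Z_k is
    square-integrable. *)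
Lemma measurable_Zk_sqr (S : R) :
  (forall n, \sum_(0 <= l < n) (p l)^-1 *
     ((k%:R - (b' k)%:R)^-1 * \sum_(b' k <= i < k) nu (start l + i)%N) <= S) ->
  measurable_fun setT (Zk g X0 U f b' p N k) /\
  (\int[P]_w (Zk g X0 U f b' p N k w ^+ 2)%:E <= S%:E)%E.
Proof.
move=> HS; pose W l w := (p l)^-1 * (fkl l.+1 w - fkl l w).
have LW l : W l \in Lfun P 2%:E by apply: Lfun2Z; apply: Lfun2B; exact: Lfun2_fkl.
have mWU l : measurable_fun (setT : set (g_sigma_algebraType (gens U setT))) (W l).
  apply: measurable_funM; first exact: measurable_cst.
  apply: measurable_funB; rewrite fklE; (apply: measurable_funM; first exact: measurable_cst);
    by apply: measurable_sum => i; apply: measurable_obs_gens.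
have ZW : Zk g X0 U f b' p N k = fun w => W (N w) w.
  by apply/funext => w; rewrite /Zk /W mulrC.
have indW l B : measurable B ->
    P (N @^-1` [set l] `&` W l @^-1` B) = (P (N @^-1` [set l]) * P (W l @^-1` B))%E.
  move=> mB; apply: indN => //.
  by have := mWU l measurableT B mB; rewrite setTI.
have [mZ IZ] := ge0_integral_mixture pN LW indW.
rewrite ZW; split=> //; rewrite IZ; apply: nneseries_le => [l|n].
  rewrite mulr_ge0 ?(ltW (p_gt0 l))//.
  by apply: mean_ge0 => w; exact: sqr_ge0.
apply: le_trans (HS n); apply: ler_sum => l _.
have -> : (fun w => W l w ^+ 2) = fun w => (p l) ^- 2 * (fkl l.+1 w - fkl l w) ^+ 2.
  by apply/funext => w; rewrite /W exprMn exprVn.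
rewrite meanZ; last by apply: Lfun2_integrableX; apply: Lfun2B; exact: Lfun2_fkl.
rewrite mulrA.
have -> : p l * p l ^- 2 = (p l)^-1 by field; rewrite gt_eqF.
by rewrite ler_wpM2l ?invr_ge0 ?(ltW (p_gt0 l))//; exact: mean_levelB_sqr.
Qed.

Lemma variance_fhat_le (q S M : R) (Z' : {RV P >-> R}) (Q : {RV P >-> bool}) :
  0 < q ->
  same_law P Z' (Zk g X0 U f b' p N k) ->
  independent_rv P Z' (fkl 0) ->
  P (Q @^-1` [set true]) = q%:E ->
  independent_rv P Q (fun w => (fkl 0 w, Z' w)) ->
  (forall L, \sum_(0 <= s < L) weight nu s <= M) ->
  (forall n, \sum_(0 <= l < n) (p l)^-1 *
     ((k%:R - (b' k)%:R)^-1 * \sum_(b' k <= i < k) nu (start l + i)%N) <= S) ->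
  (k%:R%:E * 'V_P[fun w => (fkl 0 w + q^-1 * (Q w)%:R * Z' w)%R] <=
   k%:R%:E * 'V_P[fk] +
     (16 * M ^+ 2 * Num.sqrt (((b' k)%:R - (b k)%:R) / k%:R) + k%:R * S / q)%:E)%E.
Proof.
move=> q0 lawZ indZ Qq indQ HM HS.
have [mZ IZ] := measurable_Zk_sqr HS.
have EZ : (\int[P]_w (Z' w ^+ 2)%:E = \int[P]_w (Zk g X0 U f b' p N k w ^+ 2)%:E)%E.
  apply: (@same_law_ge0_integral _ _ _ P _ _ Z' (Zk g X0 U f b' p N k)
    (fun x => (x ^+ 2)%:E)) => //.
    by apply/measurable_EFinP; exact: measurable_funX.
  by move=> x; rewrite lee_fin sqr_ge0.
have LZ : (Z' : Omega -> R) \in Lfun P 2%:E.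
  by apply/Lfun2P; split=> //; rewrite EZ (le_lt_trans IZ)// ltry.
have mZ2 : mean P (fun w => Z' w ^+ 2) <= S.
  rewrite -lee_fin /mean /Rintegral fineK ?EZ//.
  by rewrite -EZ; apply: integrable_fin_num => //; exact: Lfun2_integrable_sqr.
have [LY VY] := mean_randomized_sqr q0 (Lfun2_fkl 0) LZ indZ Qq indQ.
rewrite !varianceE_mean//; last exact: Lfun2_fk.
rewrite -!EFinM -EFinD lee_fin.
have k0 : 0 < k%:R :> R by rewrite ltr0n.
have V0 := mean_centered_fkl0_le HM.
have : mean P (fun w => centered P
    (fun w => fkl 0 w + q^-1 * (Q w)%:R * Z' w) w ^+ 2) <=
  mean P (fun w => centered P fk w ^+ 2) +
  16 * M ^+ 2 / k%:R * Num.sqrt (((b' k)%:R - (b k)%:R) / k%:R) + q^-1 * S.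
  apply: le_trans VY _; rewrite lerD// ler_wpM2l// invr_ge0 ltW//.
move=> /(ler_wpM2l (ltW k0)) /le_trans; apply.
set s := Num.sqrt _; set m := mean _ _.
by rewrite le_eqVlt; apply/orP; left; apply/eqP; field; rewrite !gt_eqF.
Qed.

End EstimatorMoments.

(** * The numerical series *)

Section DecaySums.
Context (R : realType).
Variables (nu : nat -> R) (c xi : R).
Hypotheses (c_gt0 : 0 < c) (xi01 : 0 < xi <= 1).
Hypotheses (nu_gt0 : forall i, 0 < nu i) (nu_mono : nonincreasing_seq nu).
Hypothesis nu_exp : forall i : nat, nu i <= c * expR (- xi * i%:R).
Local Notation t := (ln (3 / xi)).

Let c0 : 0 < c := c_gt0.
Let xi0 : 0 < xi. Proof. by case/andP: xi01. Qed.
Let xi1 : xi <= 1. Proof. by case/andP: xi01. Qed.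

Lemma lag_ge s : 2 ^+ s <= 2 * (lag s)%:R + 1 :> R.
Proof.
rewrite -natrX -natrM natr1 ler_nat /lag -divn2.
by move: (2 ^ s)%N => x; lia.
Qed.

Lemma weight_sqr s : weight nu s ^+ 2 = 2 ^+ s * nu (lag s).
Proof. by rewrite sqr_sqrtr// mulr_ge0 ?exprn_ge0// ltW. Qed.

(** [lag s] is at least (2^s - 1) / 2, and the lost factor exp (xi / 2) <= exp (1 / 2) is at most
    2. *)
Lemma weight_sqr_exp s : weight nu s ^+ 2 <= 2 * c * (2 ^+ s * expR (- xi * 2 ^+ s / 2)).
Proof.
have x0 := xi0; have x1 := xi1; have cp := c0.
rewrite weight_sqr; have z0 : 0 < 2 ^+ s :> R by rewrite exprn_gt0.
have -> : 2 * c * (2 ^+ s * expR (- xi * 2 ^+ s / 2)) =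
  2 ^+ s * (c * (2 * expR (- xi * 2 ^+ s / 2))) by ring.
rewrite ler_wpM2l ?(ltW z0)//; apply: le_trans (nu_exp _) _.
rewrite ler_wpM2l ?(ltW cp)//.
apply: (@le_trans _ _ (expR (2^-1 + - xi * 2 ^+ s / 2))).
  by rewrite ler_expR; have := lag_ge s; nra.
rewrite expRD ler_wpM2r ?expR_ge0// -[leRHS]invrK -[2^-1]opprK expRN.
rewrite lef_pV2 ?posrE ?expR_gt0//.
by apply: le_trans (expR_ge1Dx _); lra.
Qed.

(** Let r = sqrt (xi 2^s) and D be the denominator. Then D <= (1 + 2 r)^2 <= 32 (1 + r^2 / 4), so
    exp (r^2 / 2) >= (1 + r^2 / 4)^2 >= (D / 32)^2. The ratio of the progression is sqrt 2 because a
    weight is a square root. *)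
Lemma weight_le_exp s : weight nu s <= 32 * Num.sqrt (2 * c / xi) *
  ((Num.sqrt xi * Num.sqrt 2 ^+ s) /
   ((1 + Num.sqrt xi * Num.sqrt 2 ^+ s) * (1 + Num.sqrt xi * Num.sqrt 2 ^+ s.+1))).
Proof.
have x0 := xi0; have cp := c0.
have z0 : 0 < 2 ^+ s :> R by rewrite exprn_gt0.
set r := Num.sqrt xi * Num.sqrt 2 ^+ s.
have r0 : 0 < r by rewrite mulr_gt0 ?exprn_gt0 ?sqrtr_gt0.
have r2 : r ^+ 2 = xi * 2 ^+ s.
  by rewrite exprMn sqr_sqrtr ?(ltW x0)// -exprM mulnC exprM sqr_sqrtr.
have s20 : 0 < Num.sqrt 2 :> R by rewrite sqrtr_gt0.
have s22 : Num.sqrt 2 ^+ 2 = 2 :> R by rewrite sqr_sqrtr.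
have s2l : Num.sqrt 2 <= 2 :> R by rewrite -(@ler_sqr R) ?nnegrE ?sqrtr_ge0// s22; lra.
have -> : Num.sqrt xi * Num.sqrt 2 ^+ s.+1 = Num.sqrt 2 * r by rewrite exprS /r; ring.
clearbody r.
set D := (1 + r) * (1 + Num.sqrt 2 * r).
have D0 : 0 < D by rewrite /D; nra.
have DL : D <= 32 * (1 + xi * 2 ^+ s / 4).
  apply: (@le_trans _ _ ((1 + 2 * r) ^+ 2)); last by rewrite -r2; nra.
  by rewrite /D expr2 ler_pM//; nra.
clearbody D.
rewrite -(@ler_sqr R) ?nnegrE ?sqrtr_ge0//; last first.
  by rewrite !mulr_ge0 ?sqrtr_ge0 ?invr_ge0 ?(ltW D0)// ltW.
apply: le_trans (weight_sqr_exp s) _.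
have -> : (32 * Num.sqrt (2 * c / xi) * (r / D)) ^+ 2 =
    2 * c * (2 ^+ s * (D / 32) ^- 2).
  rewrite !exprMn sqr_sqrtr ?divr_ge0 ?mulr_ge0 ?(ltW x0) ?(ltW cp)// r2.
  move: (2 ^+ s) z0 => z z0.
  by field; rewrite !gt_eqF.
rewrite ler_wpM2l ?mulr_ge0 ?(ltW cp)// ler_wpM2l ?(ltW z0)//.
have -> : - xi * 2 ^+ s / 2 = - (xi * 2 ^+ s / 2) by ring.
rewrite expRN lef_pV2 ?posrE ?expR_gt0 ?exprn_gt0 ?divr_gt0//.
have xz : 0 <= xi * 2 ^+ s / 2 by rewrite divr_ge0 ?mulr_ge0 ?(ltW x0) ?(ltW z0).
apply: le_trans (expR_ge_pow 1 xz).
by rewrite lerXn2r ?nnegrE ?divr_ge0 ?(ltW D0)//; [lra|rewrite ler_pdivrMr//; lra].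
Qed.

Lemma sum_weight_exp L : \sum_(0 <= s < L) weight nu s <= 96 * Num.sqrt (2 * c / xi).
Proof.
have x0 := xi0.
have s22 : Num.sqrt 2 ^+ 2 = 2 :> R by rewrite sqr_sqrtr.
(* This gives 1 / (sqrt 2 - 1) <= 3, hence 96 = 32 * 3. *)
have s2l : 4 / 3 <= Num.sqrt 2 :> R by rewrite -(@ler_sqr R) ?nnegrE ?sqrtr_ge0// s22; lra.
apply: (@le_trans _ _ (\sum_(0 <= s < L) (32 * Num.sqrt (2 * c / xi) *
  ((Num.sqrt xi * Num.sqrt 2 ^+ s) /
   ((1 + Num.sqrt xi * Num.sqrt 2 ^+ s) * (1 + Num.sqrt xi * Num.sqrt 2 ^+ s.+1)))))).
  by apply: ler_sum => s _; exact: weight_le_exp.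
rewrite -mulr_sumr.
have h := @telescoping_sum_le R (Num.sqrt xi) (Num.sqrt 2) L.
have {}h := le_trans (h (ltac:(by rewrite sqrtr_gt0)) (ltac:(lra)))
  (_ : (Num.sqrt 2 - 1)^-1 <= 3).
have -> : 96 * Num.sqrt (2 * c / xi) = 32 * Num.sqrt (2 * c / xi) * 3 by ring.
rewrite ler_wpM2l ?mulr_ge0 ?sqrtr_ge0//; apply: h.
by rewrite invf_ple ?posrE; lra.
Qed.

(* 1 / p_l <= 2 theta(l) 2^l and k / (k - b') <= 2. *)
Lemma level_term_le delta (k b' l : nat) : 1 < delta -> delta <= 2 ->
  (0 < k)%N -> (2 * b' <= k)%N ->
  k%:R * ((p_theta delta l)^-1 * ((k%:R - b'%:R)^-1 *
    \sum_(b' <= i < k) nu (k * (2 ^ l - 1) + i)%N)) <=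
  4 * (theta delta l%:R * 2 ^+ l * \sum_(b' <= i < k) nu (k * (2 ^ l - 1) + i)%N).
Proof.
move=> d1 d2 k0 bk; set S := \sum_(_ <= _ < _) _.
have S0 : 0 <= S by apply: sumr_ge0 => i _; exact/ltW.
have kr : 0 < k%:R :> R by rewrite ltr0n.
have bkr : 2 * b'%:R <= k%:R :> R by rewrite -natrM ler_nat.
have h1 := p_thetaV_le d1 d2 l.
have h2 : k%:R * (k%:R - b'%:R)^-1 <= 2 :> R by rewrite ler_pdivrMr; lra.
have p0 : 0 <= (p_theta delta l)^-1 by rewrite invr_ge0 ltW// p_theta_gt0.
have q0 : 0 <= k%:R * (k%:R - b'%:R)^-1 :> R by rewrite divr_ge0; lra.
have -> : k%:R * ((p_theta delta l)^-1 * ((k%:R - b'%:R)^-1 * S)) =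
  (p_theta delta l)^-1 * (k%:R * (k%:R - b'%:R)^-1) * S by ring.
have -> : 4 * (theta delta l%:R * 2 ^+ l * S) = (2 * (theta delta l%:R * 2 ^+ l)) * 2 * S.
  by ring.
by rewrite ler_wpM2r// ler_pM.
Qed.

(** With y = x 2^l and x >= xi, 2^l <= (1 + y) (3 / xi), so l ln 2 <= y + t and l <= 2 t (1 + y).
    The logarithm is thus separated from a factor polynomial in y, which exp (- y / 2) can
    absorb. *)
Lemma theta_le_ln delta (x : R) l : 1 < delta -> delta <= 2 -> xi <= x ->
  theta delta l%:R <= 4 * t `^ delta * (1 + x * 2 ^+ l) ^+ 2.
Proof.
move=> d1 d2 xx; have x0 := xi0; have t1 := ln3V_ge1 xi01; have l2 := ln2_ge_half R.
have z0 : 0 < 2 ^+ l :> R by rewrite exprn_gt0.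
have y0 : 0 < x * 2 ^+ l by rewrite mulr_gt0//; lra.
set y := x * 2 ^+ l in y0 *.
have lt : l%:R <= 2 * t * (1 + y).
  have h : l%:R * ln 2 <= y + t.
    rewrite mulr_natl -lnXn//.
    apply: (@le_trans _ _ (ln ((1 + y) * (3 / xi)))).
      rewrite ler_ln ?posrE//; last by rewrite mulr_gt0 ?divr_gt0//; lra.
      rewrite mulrA ler_pdivlMr//; apply: (@le_trans _ _ y); last by lra.
      by rewrite /y mulrC ler_wpM2r// ltW.
    rewrite lnM ?posrE ?divr_gt0//; last by lra.
    by rewrite lerD2r; apply: le_ln1Dx; lra.
  have : 0 <= l%:R * (ln 2 - 1 / 2) :> R by apply: mulr_ge0 => //; lra.
  by nra.
have m1 : 1 <= 2 * t * (1 + y) by nra.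
have -> : 4 * t `^ delta * (1 + y) ^+ 2 = t `^ delta * (2 * (1 + y)) ^+ 2 by ring.
apply: (@le_trans _ _ ((t * (2 * (1 + y))) `^ delta)).
  rewrite /theta ge0_ler_powR ?nnegrE ?le_max ?ler01//; [lra|nra|].
  by rewrite ge_max; apply/andP; split; lra.
rewrite powRM; [|lra|lra].
by rewrite ler_wpM2l ?powR_ge0// powR_le_sqr//; lra.
Qed.

Lemma sum_nu_le (b' k m : nat) : (0 < k)%N ->
  \sum_(b' <= i < k) nu (m + i)%N <= k%:R * nu (m + b')%N.
Proof.
move=> k0; apply: (@le_trans _ _ (\sum_(b' <= i < k) nu (m + b')%N)).
  rewrite big_nat_cond [leRHS]big_nat_cond; apply: ler_sum => i /andP[/andP[bi _] _].
  by apply: nu_mono; rewrite leq_add2l.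
rewrite sumr_const_nat -[leLHS]mulr_natl ler_wpM2r ?(ltW (nu_gt0 _))// ler_nat.
exact: leq_subr.
Qed.

(** At l = 0 the shift is zero, which is why both sums over levels treat level 0 apart. *)
Lemma half_shift_le (k l : nat) : (0 < l)%N ->
  k%:R * 2 ^+ l / 2 <= (k * (2 ^ l - 1))%N%:R :> R.
Proof.
move=> l0; rewrite ler_pdivrMr// -natrX -!natrM ler_nat -mulnA leq_mul2l.
apply/orP; right; case: l l0 => // l _.
have : (0 < 2 ^ l)%N by rewrite expn_gt0.
by rewrite expnS; move: (2 ^ l)%N => x; lia.
Qed.

(** With y = xi k 2^l, a level l >= 1 is at most a constant times y (1 + y)^2 exp (- y / 2), and
    this is dominated by the telescoping term y / ((1 + y) (1 + 2 y)). *)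
Lemma sum_level_exp delta (k b' n : nat) : 1 < delta -> delta <= 2 ->
  (0 < k)%N -> (2 * b' <= k)%N ->
  k%:R * \sum_(0 <= l < n) ((p_theta delta l)^-1 * ((k%:R - b'%:R)^-1 *
    \sum_(b' <= i < k) nu (k * (2 ^ l - 1) + i)%N)) <=
  (2 ^+ 20 + 8) * (c / xi * expR (- xi * b'%:R) * t `^ delta).
Proof.
move=> d1 d2 k0 bk; have x0 := xi0; have x1 := xi1; have cp := c0.
have t1 := ln3V_ge1 xi01.
have kr : 1 <= k%:R :> R by rewrite ler1n.
set x := xi * k%:R.
have xx : xi <= x by rewrite /x; nra.
have xp : 0 < x by lra.
set E := c / xi * expR (- xi * b'%:R).
have E0 : 0 < E by rewrite mulr_gt0 ?expR_gt0 ?divr_gt0.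
have EE : E = c / xi * expR (- xi * b'%:R) by [].
clearbody E.
have T1 : 1 <= t `^ delta.
  by rewrite -[leLHS](powRr0 t) ler_powR//; lra.
pose tau l := (x * 2 ^+ l) / ((1 + x * 2 ^+ l) * (1 + x * 2 ^+ l.+1)).
have z0 l : 0 < 2 ^+ l :> R by rewrite exprn_gt0.
have tau0 l : 0 <= tau l.
  have h1 : 0 < x * 2 ^+ l by rewrite mulr_gt0.
  have h2 : 0 < x * 2 ^+ l.+1 by rewrite mulr_gt0.
  by rewrite divr_ge0 ?mulr_ge0//; lra.
rewrite mulr_sumr.
apply: (@le_trans _ _ (\sum_(0 <= l < n)
    ((if (l < 1)%N then 8 * E else 0) + 2 ^+ 20 * (E * t `^ delta) * tau l))); last first.
  rewrite big_split/= -mulr_sumr.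
  have -> : (2 ^+ 20 + 8) * (E * t `^ delta) =
    8 * (E * t `^ delta) + 2 ^+ 20 * (E * t `^ delta) by ring.
  apply: lerD; last first.
    rewrite ler_piMr ?mulr_ge0 ?exprn_ge0 ?powR_ge0 ?(ltW E0)//.
    apply: le_trans (telescoping_sum_le (rho := 2) n xp _) _; first by lra.
    by rewrite invf_le1; lra.
  apply: le_trans (sum_indicator_le 1 n _) _; first by rewrite mulr_ge0 ?(ltW E0).
  by rewrite mul1r ler_wpM2l// ler_peMr ?(ltW E0).
apply: ler_sum => l _.
apply: le_trans (level_term_le l d1 d2 k0 bk) _.
case: l => [|l].
  (* At level 0 the geometric sum over i gives 4 * 2 * E. *)
  rewrite expn0 subnn muln0 expr0 mulr1 ltnSn.
  have -> : theta delta 0%:R = 1 by rewrite /theta max_l ?powR1.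
  rewrite mul1r; apply: (@le_trans _ _ (8 * E)); last first.
    rewrite lerDl; apply: mulr_ge0 (tau0 _).
    by rewrite !mulr_ge0 ?exprn_ge0 ?powR_ge0 ?(ltW E0).
  apply: (@le_trans _ _ (4 * (c * (2 / xi * expR (- xi * b'%:R))))).
    rewrite ler_wpM2l//; apply: (@le_trans _ _ (\sum_(b' <= i < k) c * expR (- xi * i%:R))).
      by apply: ler_sum => i _; rewrite add0n.
    by rewrite -mulr_sumr ler_wpM2l ?(ltW cp)// sum_expR_le.
  by rewrite le_eqVlt; apply/orP; left; apply/eqP; rewrite EE; field; rewrite gt_eqF.
rewrite add0r.
set y := x * 2 ^+ l.+1.
have y0 : 0 < y by rewrite mulr_gt0.
have th := theta_le_ln l.+1 d1 d2 xx.
have th0 : 0 <= theta delta l.+1%:R by have := theta_ge1 d1 d2 l.+1%:R; lra.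
have hS : \sum_(b' <= i < k) nu (k * (2 ^ l.+1 - 1) + i)%N <=
    k%:R * (c * (expR (- xi * b'%:R) * expR (- (y / 2)))).
  apply: le_trans (sum_nu_le b' _ k0) _; rewrite ler_wpM2l//.
  apply: le_trans (nu_exp _) _; rewrite ler_wpM2l ?(ltW cp)// -expRD ler_expR natrD.
  by have := half_shift_le k (ltn0Sn l); rewrite /y /x; nra.
have e0 : 0 < expR (- (y / 2)) by exact: expR_gt0.
apply: (@le_trans _ _ (4 * (4 * t `^ delta * (1 + y) ^+ 2 * 2 ^+ l.+1 *
    (k%:R * (c * (expR (- xi * b'%:R) * expR (- (y / 2)))))))).
  rewrite ler_wpM2l// ler_pM ?mulr_ge0 ?(ltW (z0 _))//.
    by apply: sumr_ge0 => i _; exact/ltW.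
  by rewrite ler_wpM2r ?(ltW (z0 _)).
have -> : 4 * (4 * t `^ delta * (1 + y) ^+ 2 * 2 ^+ l.+1 *
    (k%:R * (c * (expR (- xi * b'%:R) * expR (- (y / 2)))))) =
    16 * (E * t `^ delta) * (y * ((1 + y) ^+ 2 * expR (- (y / 2)))).
  by rewrite EE /y /x; field; rewrite gt_eqF.
have -> : 2 ^+ 20 * (E * t `^ delta) * tau l.+1 =
    16 * (E * t `^ delta) * (y * (16 ^+ 4 / ((1 + y) * (1 + 2 * y)))).
  rewrite /tau -/y; have -> : x * 2 ^+ l.+2 = 2 * y by rewrite /y exprS; ring.
  by field; rewrite !gt_eqF//; lra.
rewrite ler_wpM2l ?mulr_ge0 ?powR_ge0 ?(ltW E0)// ler_wpM2l ?(ltW y0)//.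
have y2 : 0 <= y / 2 by rewrite divr_ge0 ?ltW.
have h := expR_ge_pow 3 y2.
have D0 : 0 < (1 + y) * (1 + 2 * y) by nra.
rewrite expRN ler_pdivlMr// mulrAC ler_pdivrMr ?expR_gt0//.
(* (1 + y)^2 (1 + y) (1 + 2 y) <= (1 + 2 y)^4 <= 16^4 (1 + y / 8)^4 <= 16^4 exp (y / 2), and 16 *
   16^4 = 2^20. *)
apply: (@le_trans _ _ ((1 + 2 * y) ^+ 4)).
  have -> : (1 + 2 * y) ^+ 4 = (1 + 2 * y) ^+ 2 * ((1 + 2 * y) * (1 + 2 * y)) by ring.
  apply: ler_pM; [exact: sqr_ge0|exact: ltW| |].
    by rewrite lerXn2r ?nnegrE; lra.
  by rewrite ler_wpM2r; lra.
apply: (@le_trans _ _ (16 ^+ 4 * (1 + y / 2 / 4) ^+ 4)); last by rewrite ler_wpM2l.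
by rewrite -exprMn lerXn2r ?nnegrE; lra.
Qed.

(** * The additional decay nu(i) <= c / (i + 1) *)

Section Harmonic.
Hypothesis nu_harm : forall i : nat, nu i <= c / i.+1%:R.

Lemma weight_sqr_harm s : weight nu s ^+ 2 <= 2 * c.
Proof.
have cp := c0; rewrite weight_sqr; have z0 : 0 < 2 ^+ s :> R by rewrite exprn_gt0.
apply: (@le_trans _ _ (2 ^+ s * (c / (lag s).+1%:R))).
  by rewrite ler_wpM2l ?(ltW z0).
by rewrite mulrA ler_pdivrMr ?ltr0n// -natr1; have := lag_ge s; nra.
Qed.

Lemma weight_sqr_tail s : xi ^- 2 <= 2 ^+ s ->
  weight nu s ^+ 2 <= 2 * c * (12 ^+ 6 / (2 ^+ s) ^+ 2).
Proof.
move=> xs; have x0 := xi0; have cp := c0; have z0 : 0 < 2 ^+ s :> R by rewrite exprn_gt0.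
apply: le_trans (weight_sqr_exp s) _; rewrite ler_wpM2l ?mulr_ge0 ?(ltW cp)//.
have -> : 12 ^+ 6 / (2 ^+ s) ^+ 2 = 2 ^+ s * (12 ^+ 6 / (2 ^+ s) ^+ 3) :> R.
  by move: (2 ^+ s) z0 => z z0; field; rewrite gt_eqF.
by rewrite ler_wpM2l ?(ltW z0)// expR_decay.
Qed.

Lemma tail_level L s : xi ^- 2 <= 2 ^+ L -> (L <= s)%N -> xi ^- 2 <= 2 ^+ s :> R.
Proof. by move=> xL Ls; apply: le_trans xL _; rewrite ler_weXn2l// ler1n. Qed.

(** Below the level L of [exists_level] each weight is at most sqrt (2 c), and there are at most 5 t
    of them; from L on they are at most 12^3 2^-s sqrt (2 c). Thus 3461 = 5 + 2 * 12^3. *)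
Lemma sum_weight_harm n : \sum_(0 <= s < n) weight nu s <= 3461 * Num.sqrt (2 * c) * t.
Proof.
have cp := c0; have t1 := ln3V_ge1 xi01; have [L [L0 Lt xL]] := exists_level xi01.
set q := Num.sqrt (2 * c).
have q0 : 0 < q by rewrite sqrtr_gt0 mulr_gt0.
have q2 : q ^+ 2 = 2 * c by rewrite sqr_sqrtr// mulr_ge0// ltW.
have w0 s : 0 <= weight nu s by exact: sqrtr_ge0.
apply: (@le_trans _ _ (\sum_(0 <= s < n) ((if (s < L)%N then q else 0)
    + q * 12 ^+ 3 * 2 ^- s))).
  apply: ler_sum => s _; have z0 : 0 < 2 ^+ s :> R by rewrite exprn_gt0.
  have r0 : 0 <= q * 12 ^+ 3 * 2 ^- s.
    by rewrite !mulr_ge0 ?exprn_ge0 ?invr_ge0 ?(ltW q0) ?(ltW z0).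
  case: ltnP => sL.
    apply: (@le_trans _ _ q); last by rewrite lerDl.
    by rewrite -(@ler_sqr R) ?nnegrE ?(ltW q0)// q2 weight_sqr_harm.
  rewrite add0r -(@ler_sqr R) ?nnegrE//.
  have -> : (q * 12 ^+ 3 * 2 ^- s) ^+ 2 = 2 * c * (12 ^+ 6 / (2 ^+ s) ^+ 2).
    by rewrite -q2; move: (2 ^+ s) z0 => z z0; field; rewrite gt_eqF.
  by apply: weight_sqr_tail; exact: tail_level xL sL.
rewrite big_split/= -mulr_sumr.
have h1 := sum_indicator_le L n (ltW q0).
have h2 : q * 12 ^+ 3 * \sum_(0 <= s < n) 2 ^- s <= q * 12 ^+ 3 * 2.
  by rewrite ler_wpM2l ?sum_geometric_half// mulr_ge0 ?exprn_ge0// ltW.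
apply: le_trans (lerD h1 h2) _.
have h3 : L%:R * q <= 5 * t * q by rewrite ler_wpM2r// ltW.
have h4 : q * 12 ^+ 3 * 2 <= q * 12 ^+ 3 * 2 * t.
  by rewrite ler_peMr// !mulr_ge0 ?exprn_ge0// ltW.
apply: le_trans (lerD h3 h4) _.
by rewrite le_eqVlt; apply/orP; left; apply/eqP; ring.
Qed.

(** Cauchy condensation: the block [2^n, 2^(n + 1)) has 2^n terms, each at most nu(2^n), and
    weight(n + 1)^2 = 2^(n + 1) nu(2^n). *)
Lemma sum_nu_condensation n :
  \sum_(0 <= i < 2 ^ n) nu i <= \sum_(0 <= s < n.+1) weight nu s ^+ 2.
Proof.
elim: n => [|n IH]; first by rewrite expn0 !big_nat1 weight_sqr expr0 mul1r.
rewrite [leRHS]big_nat_recr//= [leLHS](@big_cat_nat _ _ _ (2 ^ n)%N)//=; last by rewrite leq_exp2l.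
apply: lerD => //; rewrite weight_sqr lagS.
have e : (2 ^ n.+1 = 2 ^ n + 2 ^ n)%N by rewrite expnS mul2n addnn.
apply: (@le_trans _ _ (\sum_(2 ^ n <= i < 2 ^ n.+1) nu (2 ^ n)%N)).
  rewrite big_nat_cond [leRHS]big_nat_cond; apply: ler_sum => i /andP[/andP[ni _] _].
  exact: nu_mono.
rewrite sumr_const_nat e addnK -[leLHS]mulr_natl natrX ler_wpM2r ?(ltW (nu_gt0 _))//.
by rewrite exprS ler_peMl ?exprn_ge0// ler1n.
Qed.

(** Serves level 0, where the sum must be of order ln (3 / xi) instead of 1 / xi. The squared
    weights are split at L as in [sum_weight_harm]. *)
Lemma sum_nu_harm k : \sum_(0 <= i < k) nu i <= 2 * c * (5 * t + 2 * 12 ^+ 6).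
Proof.
have cp := c0; have [L [L0 Lt xL]] := exists_level xi01.
have hk : (k <= 2 ^ k)%N by rewrite ltnW// ltn_expl.
apply: (@le_trans _ _ (\sum_(0 <= i < 2 ^ k) nu i)).
  rewrite [leRHS](@big_cat_nat _ _ _ k)//= lerDl; apply: sumr_ge0 => i _; exact: ltW.
apply: le_trans (sum_nu_condensation k) _.
apply: (@le_trans _ _ (\sum_(0 <= s < k.+1) (2 * c * (if (s < L)%N then 1 else 0)
    + 2 * c * 12 ^+ 6 * 2 ^- s))).
  apply: ler_sum => s _; have z1 : 1 <= 2 ^+ s :> R by rewrite exprn_ege1// ler1n.
  have r0 : 0 <= 2 * c * 12 ^+ 6 * 2 ^- s.
    by rewrite !mulr_ge0 ?exprn_ge0 ?invr_ge0 ?(ltW cp)//; lra.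
  case: ltnP => sL.
    by apply: le_trans (weight_sqr_harm s) _; rewrite mulr1 lerDl.
  rewrite mulr0 add0r; apply: le_trans (weight_sqr_tail (tail_level xL sL)) _.
  rewrite -[leRHS]mulrA ler_wpM2l ?mulr_ge0 ?(ltW cp)// ler_wpM2l ?exprn_ge0//.
  rewrite lef_pV2 ?posrE ?exprn_gt0//; try lra.
  by rewrite expr2 ler_peMr//; lra.
rewrite big_split/= -!mulr_sumr.
have h1 := sum_indicator_le L k.+1 (@ler01 R).
have h2 := sum_geometric_half R k.+1.
have h3 : 12 ^+ 6 * \sum_(0 <= s < k.+1) 2 ^- s <= 12 ^+ 6 * 2 :> R.
  by rewrite ler_wpM2l ?exprn_ge0.
move: (\sum_(0 <= s < k.+1) (if _ then _ else _)) (\sum_(0 <= s < k.+1) 2 ^- s) h1 h3.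
move=> A B h1 h3.
have c2 : 0 <= 2 * c by lra.
by have := ler_wpM2l c2 (lerD (le_trans h1 (_ : _ <= 5 * t)) h3); rewrite mulr1; lra.
Qed.

(** Three pieces, each compared with t^(delta + 2) through t >= 1. Level 0 gives c (40 t + 16 *
    12^6). The levels below L, at most 5 t of them, give 8 c theta(L) <= 200 c t^delta each. In the
    tail the sum of (l^2 + 1) / 2^l gives 32 * 12^6 c. *)
Lemma sum_level_harm delta (k b' n : nat) : 1 < delta -> delta <= 2 ->
  (0 < k)%N -> (2 * b' <= k)%N ->
  k%:R * \sum_(0 <= l < n) ((p_theta delta l)^-1 * ((k%:R - b'%:R)^-1 *
    \sum_(b' <= i < k) nu (k * (2 ^ l - 1) + i)%N)) <=
  (48 * 12 ^+ 6 + 1040) * (c * t `^ (delta + 2)).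
Proof.
move=> d1 d2 k0 bk; have x0 := xi0; have x1 := xi1; have cp := c0.
have t1 := ln3V_ge1 xi01; have [L [L0 Lt xL]] := exists_level xi01.
have kr : 1 <= k%:R :> R by rewrite ler1n.
pose s0 := 4 * (2 * c * (5 * t + 2 * 12 ^+ 6)).
have s00 : 0 <= s0.
  by rewrite /s0 mulr_ge0// mulr_ge0 ?mulr_ge0 ?(ltW cp)// addr_ge0 ?mulr_ge0 ?exprn_ge0//; lra.
pose tl l : R := 4 * 12 ^+ 6 * c * ((l%:R ^+ 2 + 1) / 2 ^+ l).
have tl0 l : 0 <= tl l.
  apply: mulr_ge0; first by rewrite !mulr_ge0 ?exprn_ge0 ?(ltW cp).
  by rewrite divr_ge0 ?exprn_ge0// addr_ge0 ?exprn_ge0.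
have thL : 0 <= 8 * c * theta delta L%:R.
  by rewrite !mulr_ge0 ?(ltW cp)//; have := theta_ge1 d1 d2 L%:R; lra.
rewrite mulr_sumr.
apply: (@le_trans _ _ (\sum_(0 <= l < n) ((if (l < 1)%N then s0 else 0) +
   (if (l < L)%N then 8 * c * theta delta L%:R else 0) + tl l))).
  apply: ler_sum => l _; apply: le_trans (level_term_le l d1 d2 k0 bk) _.
  case: l => [|l].
    rewrite expn0 subnn muln0 expr0 mulr1 ltnSn L0.
    have -> : theta delta 0%:R = 1 by rewrite /theta max_l ?powR1.
    rewrite mul1r -addrA; apply: (@le_trans _ _ s0); last by rewrite lerDl addr_ge0.
    rewrite ler_wpM2l//; apply: le_trans (sum_nu_harm k).
    have b'k : (b' <= k)%N := leq_trans (@leq_pmull b' 2 isT) bk.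
    rewrite [leRHS](big_cat_nat (leq0n b') b'k)/=.
    under eq_bigr do rewrite add0n.
    by rewrite lerDr; apply: sumr_ge0 => i _; exact: ltW.
  rewrite add0r.
  have z0 : 0 < 2 ^+ l.+1 :> R by rewrite exprn_gt0.
  have z1 : 1 <= 2 ^+ l.+1 :> R by rewrite exprn_ege1// ler1n.
  set z := k%:R * 2 ^+ l.+1 : R.
  have zz : 2 ^+ l.+1 <= z by rewrite /z ler_peMl// ltW.
  have zp : 0 < z by lra.
  set m := (k * (2 ^ l.+1 - 1))%N.
  have mz : z / 2 <= m%:R by exact: half_shift_le.
  have zE : z = k%:R * 2 ^+ l.+1 by [].
  have zge1 : 1 <= z := le_trans z1 zz.
  clearbody z.
  set th := theta delta l.+1%:R.
  have th1 : 1 <= th by exact: theta_ge1.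
  have hS : th * 2 ^+ l.+1 * \sum_(b' <= i < k) nu (m + i)%N <= th * (z * nu m).
    rewrite -mulrA ler_wpM2l//; first by lra.
    have -> : z * nu m = 2 ^+ l.+1 * (k%:R * nu m) by rewrite zE; ring.
    rewrite ler_wpM2l ?(ltW z0)//; apply: le_trans (sum_nu_le b' m k0) _.
    by rewrite ler_wpM2l//; apply: nu_mono; exact: leq_addr.
  apply: (@le_trans _ _ (4 * (th * (z * nu m)))); first by rewrite ler_wpM2l.
  case: ltnP => lL.
    apply: (@le_trans _ _ (8 * c * theta delta L%:R)); last by rewrite lerDl.
    have hm : z * nu m <= 2 * c.
      apply: (@le_trans _ _ (z * (c / m.+1%:R))); first by rewrite ler_wpM2l ?(ltW zp).
      by rewrite mulrA ler_pdivrMr ?ltr0n// -natr1; nra.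
    have hth : th <= theta delta L%:R by rewrite theta_le// ler_nat ltnW.
    have : th * (z * nu m) <= theta delta L%:R * (2 * c).
      by rewrite ler_pM// ?mulr_ge0 ?(ltW zp) ?(ltW (nu_gt0 _))//; lra.
    lra.
  rewrite add0r.
  have xz : xi ^- 2 <= z by apply: le_trans zz; exact: tail_level xL lL.
  have hm : z * nu m <= 12 ^+ 6 * c / 2 ^+ l.+1.
    apply: (@le_trans _ _ (z * (c * (12 ^+ 6 / z ^+ 3)))).
      rewrite ler_wpM2l ?(ltW zp)//; apply: le_trans (nu_exp _) _.
      rewrite ler_wpM2l ?(ltW cp)//; apply: le_trans (expR_decay x0 zp xz).
      by rewrite ler_expR; nra.
    have -> : z * (c * (12 ^+ 6 / z ^+ 3)) = 12 ^+ 6 * c / z ^+ 2.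
      by field; rewrite gt_eqF.
    rewrite ler_wpM2l ?mulr_ge0 ?exprn_ge0 ?(ltW cp)// lef_pV2 ?posrE ?exprn_gt0//.
    by apply: le_trans zz _; rewrite expr2 ler_peMr// ltW.
  have hth : th <= l.+1%:R ^+ 2 by rewrite /th theta_le_sqr// ler1n.
  have -> : tl l.+1 = 4 * ((l.+1%:R ^+ 2 + 1) * (12 ^+ 6 * c / 2 ^+ l.+1)).
    by rewrite /tl; ring.
  rewrite ler_wpM2l// ler_pM ?mulr_ge0 ?(ltW zp) ?(ltW (nu_gt0 _))//; lra.
rewrite !big_split/= /tl -mulr_sumr.
have H1 := sum_indicator_le 1 n s00.
have H2 := sum_indicator_le L n thL.
have H3 : 4 * 12 ^+ 6 * c * (\sum_(0 <= l < n) (l%:R ^+ 2 + 1) / 2 ^+ l) <=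
    4 * 12 ^+ 6 * c * 8.
  by rewrite ler_wpM2l ?sum_sqr_half// !mulr_ge0 ?exprn_ge0 ?(ltW cp).
have T1 : 1 <= t `^ delta.
  by rewrite -[leLHS](powRr0 t) ler_powR//; lra.
have TD : t `^ (delta + 2) = t `^ delta * t ^+ 2.
  have t0 : 0 < t by lra.
  by rewrite powRD ?powR_mulrn ?(ltW t0)// (gt_eqF t0) implybT.
have hL : theta delta L%:R <= 25 * t `^ delta.
  apply: (@le_trans _ _ ((t * 5) `^ delta)).
    rewrite /theta ge0_ler_powR ?nnegrE ?le_max ?ler01//; [lra|lra|].
    by rewrite ge_max; apply/andP; split; lra.
  rewrite powRM; [|lra|lra]; rewrite mulrC ler_wpM2r ?powR_ge0//.
  by apply: le_trans (powR_le_sqr d1 d2 _) _; lra.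
have H2' : L%:R * (8 * c * theta delta L%:R) <= 5 * t * (8 * c * (25 * t `^ delta)).
  rewrite ler_pM//.
  by rewrite ler_wpM2l ?mulr_ge0 ?(ltW cp).
apply: le_trans (lerD (lerD H1 (le_trans H2 H2')) H3) _.
rewrite mul1r /s0 TD; set T := t `^ delta in T1 *.
have a1 : t <= T * t ^+ 2 by nra.
have a2 : t * T <= T * t ^+ 2 by nra.
have a3 : 1 <= T * t ^+ 2 by nra.
have -> : 4 * (2 * c * (5 * t + 2 * 12 ^+ 6)) + 5 * t * (8 * c * (25 * T)) +
  4 * 12 ^+ 6 * c * 8 = c * (40 * t + 1000 * (t * T) + 48 * 12 ^+ 6) by ring.
have -> : (48 * 12 ^+ 6 + 1040) * (c * (T * t ^+ 2)) =
  c * (40 * (T * t ^+ 2) + 1000 * (T * t ^+ 2) + 48 * 12 ^+ 6 * (T * t ^+ 2)) by ring.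
rewrite ler_wpM2l ?(ltW cp)//.
by move: (T * t ^+ 2) (t * T) a1 a2 a3 => X Y a1 a2 a3; lra.
Qed.

End Harmonic.
End DecaySums.

(** * Convergence of the two series and the expected cost *)

Section Summability.
Context (R : realType).
Variables (nu : nat -> R) (c xi delta : R).
Hypotheses (c_gt0 : 0 < c) (xi01 : 0 < xi <= 1).
Hypotheses (delta_gt1 : 1 < delta) (delta_le2 : delta <= 2).

Lemma sum_invr_sqr_le n : \sum_(0 <= i < n) (i.+1%:R ^- 2 : R) <= 2.
Proof.
apply: (@le_trans _ _ (\sum_(0 <= i < n) (- 2 * i.+2%:R^-1 - - 2 * i.+1%:R^-1))).
  apply: ler_sum => i _; have i0 : 0 < i.+1%:R :> R by rewrite ltr0n.
  have i1 : 1 <= i.+1%:R :> R by rewrite ler1n.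
  rewrite -(natr1 i.+1); move: (i.+1%:R) i0 i1 => x x0 x1.
  have -> : - 2 * (x + 1)^-1 - - 2 * x^-1 = 2 / (x * (x + 1)).
    by field; rewrite !gt_eqF//; lra.
  by rewrite ler_pdivlMr; [rewrite mulrC ler_pdivrMr; nra|nra].
rewrite telescope_sumr//= invr1.
by have : 0 <= n.+1%:R^-1 :> R by [rewrite invr_ge0]; move: (n.+1%:R^-1) => y; lra.
Qed.

(** Put x = i + 1. The logarithm is at most 8 x, so theta contributes at most 64 x^2; the fifth
    power (xi x / 5)^5 below exp (xi x), together with the division by x, leaves x^-4, whose square
    root is summable. The factor 3 bounds exp xi, and 192 = 64 * 3. *)
Lemma sqrt_nu_theta_le (i : nat) : nu i <= c * expR (- xi * i%:R) -> 0 < nu i ->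
  Num.sqrt (nu i * theta delta (log2 (4 * i%:R + 1)) / i.+1%:R) <=
  Num.sqrt (192 * 5 ^+ 5 * c / xi ^+ 5) * i.+1%:R ^- 2.
Proof.
move=> nu_exp nu0; case/andP: xi01 => xi0 xi1; have cp := c_gt0.
have l2 := ln2_ge_half R.
have e : i%:R = i.+1%:R - 1 :> R by rewrite -natr1; ring.
have x1 : 1 <= i.+1%:R :> R by rewrite ler1n.
rewrite e in nu_exp *; move: (i.+1%:R) x1 nu_exp => x x1 nu_exp.
have x0 : 0 < x by lra.
have K0 : 0 <= 192 * 5 ^+ 5 * c / xi ^+ 5.
  by rewrite divr_ge0 ?exprn_ge0 ?mulr_ge0 ?exprn_ge0// ltW.
have -> : Num.sqrt (192 * 5 ^+ 5 * c / xi ^+ 5) * x ^- 2 =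
    Num.sqrt (192 * 5 ^+ 5 * c / xi ^+ 5 * (x ^- 2) ^+ 2).
  by rewrite [RHS]sqrtrM// sqrtr_sqr ger0_norm// invr_ge0 exprn_ge0// ltW.
apply: ler_wsqrtr.
have hlog : log2 (4 * (x - 1) + 1) <= 8 * x.
  rewrite /log2 ler_pdivrMr; last by lra.
  have h : ln (1 + 4 * (x - 1)) <= 4 * (x - 1) by apply: le_ln1Dx; lra.
  by rewrite addrC; nra.
have hth : theta delta (log2 (4 * (x - 1) + 1)) <= (8 * x) ^+ 2.
  by apply: theta_le_sqr => //; lra.
have th0 : 0 <= theta delta (log2 (4 * (x - 1) + 1)).
  by apply: le_trans (theta_ge1 delta_gt1 delta_le2 _); lra.
have hexp : expR (- xi * (x - 1)) <= 3 * (xi * x / 5) ^- 5.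
  have -> : - xi * (x - 1) = xi + - (xi * x) by ring.
  rewrite expRD expRN ler_pM ?expR_ge0 ?invr_ge0 ?expR_ge0//.
    by apply: le_trans (expR1_le3 R); rewrite ler_expR.
  have y0 : 0 < xi * x by rewrite mulr_gt0.
  rewrite lef_pV2 ?posrE ?expR_gt0 ?exprn_gt0 ?divr_gt0//.
  apply: le_trans (expR_ge_pow 4 (ltW y0)).
  by rewrite lerXn2r ?nnegrE; lra.
rewrite ler_pdivrMr//.
apply: (@le_trans _ _ ((c * (3 * (xi * x / 5) ^- 5)) * (8 * x) ^+ 2)).
  apply: ler_pM => //; first exact: ltW.
  by apply: le_trans nu_exp _; rewrite ler_wpM2l// ltW.
rewrite le_eqVlt; apply/orP; left; apply/eqP; field.
by rewrite !gt_eqF.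
Qed.

Lemma sum_sqrt_nu_theta_lty :
  (forall i : nat, nu i <= c * expR (- xi * i%:R)) -> (forall i, 0 < nu i) ->
  (\sum_(0 <= i <oo)
     (Num.sqrt (nu i * theta delta (log2 (4 * i%:R + 1)) / i.+1%:R))%:E < +oo)%E.
Proof.
move=> nu_exp nu0; apply: le_lt_trans (ltry (Num.sqrt (192 * 5 ^+ 5 * c / xi ^+ 5) * 2)).
apply: nneseries_le => [l|n]; first exact: sqrtr_ge0.
apply: le_trans (_ : \sum_(0 <= i < n)
    (Num.sqrt (192 * 5 ^+ 5 * c / xi ^+ 5) * i.+1%:R ^- 2) <= _).
  by apply: ler_sum => i _; exact: sqrt_nu_theta_le.
by rewrite -mulr_sumr ler_wpM2l ?sqrtr_ge0// sum_invr_sqr_le.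
Qed.

Lemma sum_invr_theta_lty :
  (\sum_(0 <= l <oo) (1 / theta delta l%:R)%:E < +oo)%E.
Proof.
apply: le_lt_trans (ltry (3 / (delta - 1))); apply: nneseries_le => [l|n].
  by rewrite div1r invr_ge0; apply: le_trans (theta_ge1 delta_gt1 delta_le2 _); lra.
exact: sum_invr_theta_le.
Qed.

(** p_l tau_{k,l} <= 3 k / theta(l), and the sum of 1 / theta(l) is at most 3 / (delta - 1): hence 9
    = 3 * 3. *)
Lemma That_le (tau : nat -> nat -> R) (q : R) (k : nat) : 0 <= q ->
  (forall l, 0 <= tau k l <= k%:R * 2 ^+ l.+1 + k%:R * 2 ^+ l) ->
  (That (p_theta delta) tau q k <= (k%:R * (1 + 9 * q / (delta - 1)))%:E)%E.
Proof.
move=> q0 tau_le; have d1 := delta_gt1; have d2 := delta_le2.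
have d0 : 0 < delta - 1 by lra.
have TkE : (Tk (p_theta delta) tau k <= (3 * k%:R * (3 / (delta - 1)))%:E)%E.
  apply: nneseries_le => [l|n].
    have /andP[t0 _] := tau_le l.
    by rewrite mulr_ge0// ltW// p_theta_gt0.
  apply: (@le_trans _ _ (\sum_(0 <= l < n) 3 * k%:R * (1 / theta delta l%:R))).
    apply: ler_sum => l _; have /andP[t0 t1] := tau_le l.
    have z0 : 0 < 2 ^+ l :> R by rewrite exprn_gt0.
    have th1 := theta_ge1 d1 d2 l%:R.
    have th0 : 0 < theta delta l%:R by lra.
    apply: (@le_trans _ _ (1 / (theta delta l%:R * 2 ^+ l) * (3 * k%:R * 2 ^+ l))).
      apply: ler_pM => //; first by rewrite ltW// p_theta_gt0.
        exact: p_theta_le.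
      by move: t1; rewrite exprS; lra.
    rewrite le_eqVlt; apply/orP; left; apply/eqP.
    by move: (2 ^+ l) z0 => z z0; field; rewrite !gt_eqF.
  by rewrite -mulr_sumr ler_wpM2l ?mulr_ge0// sum_invr_theta_le.
have -> : k%:R * (1 + 9 * q / (delta - 1)) =
   k%:R + q * (3 * k%:R * (3 / (delta - 1))) by field; rewrite gt_eqF.
by rewrite /That EFinD leeD2l// EFinM lee_wpmul2l// lee_fin.
Qed.

End Summability.

(** * Passing to the minima, and the absolute constants *)

Section Constants.
Context (R : realType).
Variables (c xi delta q bp s : R).
Hypotheses (c_gt0 : 0 < c) (xi01 : 0 < xi <= 1) (q_gt0 : 0 < q).
Hypotheses (delta_gt1 : 1 < delta) (delta_le2 : delta <= 2).
Hypotheses (bp0 : 0 <= bp) (s_ge0 : 0 <= s).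
Local Notation t := (ln (3 / xi)).

(** Bounding the exponential by 1 gives the first entry. For the second, t^delta <= t^2 <= 12 / xi
    and half of the exponent is given up. The loss is a factor 12. *)
Lemma level_exp_le_min : (2 ^+ 20 + 8) * (c / xi * expR (- xi * bp) * t `^ delta) <=
  10 ^+ 8 * (c / xi) * Num.min (t `^ delta) (expR (- xi * bp / 2) / xi).
Proof.
have /andP[xi0 xi1] := xi01; have t1 := ln3V_ge1 xi01.
have d1 := delta_gt1; have d2 := delta_le2; have bpp := bp0.
have cx : 0 < c / xi by rewrite divr_gt0.
have tt : t `^ delta <= 12 / xi.
  by apply: le_trans (powR_le_sqr d1 d2 t1) (ln3V_sqr_le xi01).
have td0 : 0 < t `^ delta by rewrite powR_gt0//; lra.
have xb : 0 <= xi * bp by rewrite mulr_ge0// ltW.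
have e1 : expR (- xi * bp) <= 1 by rewrite -expR0 ler_expR; lra.
have e2 : expR (- xi * bp) <= expR (- xi * bp / 2) by rewrite ler_expR; lra.
have e0 : 0 < expR (- xi * bp) by exact: expR_gt0.
have -> : (2 ^+ 20 + 8) * (c / xi * expR (- xi * bp) * t `^ delta) =
  c / xi * ((2 ^+ 20 + 8) * (expR (- xi * bp) * t `^ delta)) by ring.
have -> : 10 ^+ 8 * (c / xi) * Num.min (t `^ delta) (expR (- xi * bp / 2) / xi) =
  c / xi * (10 ^+ 8 * Num.min (t `^ delta) (expR (- xi * bp / 2) / xi)) by ring.
rewrite ler_wpM2l ?(ltW cx)//.
set E := expR _ in e1 e2 e0 *; set E2 := expR _ in e2 *; set T := t `^ delta in tt td0 *.
have h1 : E * T <= T by rewrite ler_piMl// ltW.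
have h2 : E * T <= 12 * (E2 / xi).
  have -> : 12 * (E2 / xi) = E2 * (12 / xi) by ring.
  by apply: ler_pM => //; exact: ltW.
have h3 : E * T / 12 <= Num.min T (E2 / xi).
  by rewrite le_min; apply/andP; split; have := mulr_gt0 e0 td0; lra.
have h4 : 0 < E * T by rewrite mulr_gt0.
by move: (E * T) (Num.min _ _) h3 h4 => X Y h3 h4; lra.
Qed.

(** The harmonic estimate gives the first entry; the second comes from the exponential one, whose
    prefactor c / xi supplies the extra power of 1 / xi. *)
Lemma level_harm_le_min (S : R) :
  S <= (2 ^+ 20 + 8) * (c / xi * expR (- xi * bp) * t `^ delta) ->
  S <= (48 * 12 ^+ 6 + 1040) * (c * t `^ (delta + 2)) ->
  S <= 10 ^+ 9 * c * Num.min (t `^ (delta + 2)) (expR (- xi * bp / 2) / xi ^+ 2).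
Proof.
move=> S1 S2; have /andP[xi0 xi1] := xi01; have cp := c_gt0.
have h1 : S <= 10 ^+ 9 * c * t `^ (delta + 2).
  have : 0 <= c * t `^ (delta + 2) by rewrite mulr_ge0 ?powR_ge0 ?(ltW cp).
  by move: S2; rewrite -[10 ^+ 9 * c * _]mulrA; move: (c * t `^ (delta + 2)) => X S2 X0; lra.
have h2 : S <= 10 ^+ 9 * c * (expR (- xi * bp / 2) / xi ^+ 2).
  apply: le_trans S1 (le_trans level_exp_le_min _).
  apply: (@le_trans _ _ (10 ^+ 8 * (c / xi) * (expR (- xi * bp / 2) / xi))).
    rewrite ler_wpM2l ?ge_min ?lexx ?orbT//.
    by rewrite mulr_ge0 ?exprn_ge0 ?divr_ge0 ?(ltW cp) ?(ltW xi0).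
  have -> : 10 ^+ 8 * (c / xi) * (expR (- xi * bp / 2) / xi) =
     10 ^+ 8 * (c * (expR (- xi * bp / 2) / xi ^+ 2)) by field; rewrite gt_eqF.
  rewrite -[10 ^+ 9 * c * _]mulrA.
  have : 0 <= c * (expR (- xi * bp / 2) / xi ^+ 2).
    by rewrite mulr_ge0 ?divr_ge0 ?expR_ge0 ?exprn_ge0 ?(ltW cp) ?(ltW xi0).
  by move: (c * _) => X X0; lra.
by rewrite minElt; case: ifP.
Qed.

End Constants.

Theorem theorem3p4 (R : realType) :
  exists A A' : R, 0 < A /\ 0 < A' /\
  forall (dF dF' dO : measure_display)
    (F : measurableType dF) (F' : measurableType dF')
    (Omega : measurableType dO) (P : probability Omega R)
    (g : F * F' -> F) (U : int -> {RV P >-> F'}) (X0 : F) (f : F -> R)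
    (b b' : nat -> nat)
    (nu : nat -> R) (c xi delta q : R)
    (N : {RV P >-> nat})
    (Z' : nat -> {RV P >-> R}) (Q : nat -> {RV P >-> bool})
    (tau : nat -> nat -> R),
  measurable_fun setT g ->
  iid P (fun i : int => U i : Omega -> F') ->
  measurable_fun setT f ->
  (forall i : nat, f \o chain g X0 U i \in Lfun P 2%:E) ->
  (forall k : nat, (1 <= k)%N ->
     (b k <= b' k)%N /\ (b' k)%:R <= k%:R / 2 :> R) ->
  (forall i : nat, 0 < nu i) ->
  nonincreasing_seq nu ->
  (\sum_(0 <= i <oo) (Num.sqrt (nu i / i.+1%:R))%:E < +oo)%E ->
  (forall i m : nat,
     ('E_P[fun w => ((f (chain_from g X0 U i m w) - f (chain g X0 U i w)) ^+ 2)%R]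
        <= (nu i)%:E)%E) ->
  0 < c -> 0 < xi <= 1 ->
  (forall i : nat, nu i <= c * expR (- xi * i%:R)) ->
  1 < delta <= 2 ->
  0 < q <= 1 ->
  independent_of_family P N (fun i : int => U i : Omega -> F') ->
  (forall l : nat, P (N @^-1` [set l]) = (p_theta delta l)%:E) ->
  (forall k : nat, (1 <= k)%N ->
     same_law P (Z' k) (Zk g X0 U f b' (p_theta delta) N k) /\
     independent_rv P (Z' k) (fkl g X0 U f b' k 0) /\
     P (Q k @^-1` [set true]) = q%:E /\
     independent_rv P (Q k) (fun w => (fkl g X0 U f b' k 0 w, Z' k w))) ->
  (forall k l : nat, (1 <= k)%N ->
     0 <= tau k l <= k%:R * 2 ^+ l.+1 + k%:R * 2 ^+ l) ->
  (\sum_(0 <= l <oo) (1 / theta delta l%:R)%:E < +oo)%E /\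
  (\sum_(0 <= i <oo)
      (Num.sqrt (nu i * theta delta (log2 (4 * i%:R + 1)) / i.+1%:R))%:E
     < +oo)%E /\
  (forall k : nat, (1 <= k)%N ->
     (That (p_theta delta) tau q k
        <= (k%:R * (1 + 9 * q / (delta - 1)))%:E)%E) /\
  (forall k : nat, (1 <= k)%N ->
     (k%:R%:E * 'V_P[fhat g X0 U f b' q (fun k => Q k) (fun k => Z' k) k]
      <= k%:R%:E * 'V_P[fk g X0 U f b k]
         + (A * c / xi * Num.sqrt (((b' k)%:R - (b k)%:R) / k%:R)
            + A * c / (q * xi) *
              Num.min (ln (3 / xi) `^ delta)
                      (expR (- xi * (b' k)%:R / 2) / xi))%:E)%E) /\
  ((forall i : nat, nu i <= c / i.+1%:R) ->
   forall k : nat, (1 <= k)%N ->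
     (k%:R%:E * 'V_P[fhat g X0 U f b' q (fun k => Q k) (fun k => Z' k) k]
      <= k%:R%:E * 'V_P[fk g X0 U f b k]
         + (A' * c * ln (3 / xi) ^+ 2 *
              Num.sqrt (((b' k)%:R - (b k)%:R) / k%:R)
            + A' * c / q *
              Num.min (ln (3 / xi) `^ (delta + 2))
                      (expR (- xi * (b' k)%:R / 2) / xi ^+ 2))%:E)%E).
Proof.
(* A has to dominate 16 * 96^2 * 2 and 12 (2^20 + 8); A' has to dominate 16 * 3461^2 * 2, 48 * 12^6
   + 1040 and A. *)
exists (10 ^+ 8), (10 ^+ 9); split; first by rewrite exprn_gt0.
split; first by rewrite exprn_gt0.
move=> dF dF' dO F F' Omega P g U X0 f b b' nu c xi delta q N Z' Q tau.
move=> mg iidU mf L2f bb' nu0 nu_mono _ nu_bound c0 xi01 nu_exp.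
move=> /andP[d1 d2] /andP[q0 q1] indN pN sim tau_le.
have /andP[xi0 xi1] := xi01.
split; first exact: sum_invr_theta_lty.
split; first exact: (sum_sqrt_nu_theta_lty c0 xi01 d1 d2).
split.
  by move=> k k1; apply: That_le => //; [exact: ltW|move=> l; exact: tau_le].
(* Both variance bounds share this form and differ only in the estimates M for the weights and B for
   k times the sum over levels. *)
have var k (k1 : (1 <= k)%N) M B :
    (forall L, \sum_(0 <= s < L) weight nu s <= M) ->
    (forall n, k%:R * \sum_(0 <= l < n) ((p_theta delta l)^-1 *
      ((k%:R - (b' k)%:R)^-1 * \sum_(b' k <= i < k) nu (k * (2 ^ l - 1) + i)%N)) <= B) ->
    (k%:R%:E * 'V_P[fhat g X0 U f b' q (fun k => Q k) (fun k => Z' k) k] <=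
     k%:R%:E * 'V_P[fk g X0 U f b k] +
     (16 * M ^+ 2 * Num.sqrt (((b' k)%:R - (b k)%:R) / k%:R) + B / q)%:E)%E.
  move=> HM HB; have [bk b'k] := bb' k k1; have [lawZ [indZ [Qq indQ]]] := sim k k1.
  have kr : 0 < k%:R :> R by rewrite ltr0n.
  have HS n : \sum_(0 <= l < n) ((p_theta delta l)^-1 *
      ((k%:R - (b' k)%:R)^-1 * \sum_(b' k <= i < k) nu (k * (2 ^ l - 1) + i)%N)) <= B / k%:R.
    by rewrite ler_pdivlMr// mulrC; exact: HB.
  have := variance_fhat_le mg iidU mf L2f nu0 nu_bound k1 bk b'k
    (p_theta_gt0 d1 d2) indN pN q0 lawZ indZ Qq indQ HM HS.
  by have -> : k%:R * (B / k%:R) / q = B / q by field; rewrite !gt_eqF.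
have bk2 k : (1 <= k)%N -> (2 * b' k <= k)%N.
  by move=> /bb'[_]; rewrite -(ler_nat R) natrM; lra.
split=> [k k1|nu_harm k k1].
  have hM := sum_weight_exp c0 xi01 nu0 nu_exp.
  have hB n := le_trans (sum_level_exp c0 xi01 nu0 nu_mono nu_exp n d1 d2 k1 (bk2 k k1))
    (level_exp_le_min c0 xi01 d1 d2 (ler0n R (b' k))).
  apply: le_trans (var k k1 _ _ hM hB) _.
  rewrite leeD2l// lee_fin; set s := Num.sqrt (_ / k%:R); set mn := Num.min _ _.
  have s0 : 0 <= s by exact: sqrtr_ge0.
  have cx : 0 <= c / xi by rewrite divr_ge0// ltW.
  apply: lerD; last first.
    by rewrite le_eqVlt; apply/orP; left; apply/eqP; field; rewrite !gt_eqF.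
  rewrite exprMn sqr_sqrtr; last by rewrite divr_ge0 ?mulr_ge0// ltW.
  rewrite ler_wpM2r//.
  have -> : 16 * (96 ^+ 2 * (2 * c / xi)) = 16 * (96 ^+ 2 * 2) * (c / xi) by ring.
  have -> : 10 ^+ 8 * c / xi = 10 ^+ 8 * (c / xi) by ring.
  by move: (c / xi) cx => y y0; lra.
have hM := sum_weight_harm c0 xi01 nu0 nu_exp nu_harm.
have hB n := level_harm_le_min c0 xi01 d1 d2 (ler0n R (b' k))
  (sum_level_exp c0 xi01 nu0 nu_mono nu_exp n d1 d2 k1 (bk2 k k1))
  (sum_level_harm c0 xi01 nu0 nu_mono nu_exp nu_harm n d1 d2 k1 (bk2 k k1)).
apply: le_trans (var k k1 _ _ hM hB) _.
rewrite leeD2l// lee_fin; set s := Num.sqrt (_ / k%:R); set mn := Num.min _ _.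
have s0 : 0 <= s by exact: sqrtr_ge0.
apply: lerD; last first.
  by rewrite le_eqVlt; apply/orP; left; apply/eqP; field; rewrite !gt_eqF.
rewrite !exprMn sqr_sqrtr; last by rewrite mulr_ge0// ltW.
rewrite ler_wpM2r//.
have ct : 0 <= c * ln (3 / xi) ^+ 2 by rewrite mulr_ge0 ?sqr_ge0// ltW.
have -> : 16 * (3461 ^+ 2 * (2 * c) * ln (3 / xi) ^+ 2) =
  16 * (3461 ^+ 2 * 2) * (c * ln (3 / xi) ^+ 2) by ring.
have -> : 10 ^+ 9 * c * ln (3 / xi) ^+ 2 = 10 ^+ 9 * (c * ln (3 / xi) ^+ 2) by ring.
by move: (c * _) ct => y y0; lra.
Qed.
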